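(* Let $T>0$ and $s\ge0$. Let $a,b\in L^\infty(0,1)$ be non-negative, let $q\in L^\infty(0,1)$ be real, with $\mathcal L=-\frac{d^2}{dx^2}+q$ the Dirichlet Sturm-Liouville operator on $(0,1)$ (whose eigenvalues are assumed positive), and let $u_0\in W^s_{\mathcal L}(0,1)$, $u_1\in L^2(0,1)$, so that the classical solution $u\in C([0,T];W^s_{\mathcal L}(0,1))\cap C^1([0,T];L^2(0,1))$ of $$\partial_t^2u+\mathcal L^su+a(x)u+b(x)u_t=0\ \text{ on }[0,T]\times(0,1),\quad u(0,\cdot)=u_0,\ u_t(0,\cdot)=u_1,\quad u(t,0)=u(t,1)=0\ (t\in[0,T])$$ exists. Then for any regularising families $(a_\varepsilon)_{\varepsilon\in(0,1]},(b_\varepsilon)_{\varepsilon\in(0,1]}$ of non-negative functions in $L^\infty(0,1)$ with $$\|a_\varepsilon-a\|_{L^\infty}\to0,\qquad \|b_\varepsilon-b\|_{L^\infty}\to0\qquad(\varepsilon\to0),$$ and any regularising families $(u_{0,\varepsilon})_\varepsilon\subset W^s_{\mathcal L}(0,1)$, $(u_{1,\varepsilon})_\varepsilon\subset L^2(0,1)$ with $$\|u_{0,\varepsilon}-u_0\|_{W^s_{\mathcal L}}\to0,\qquad\|u_{1,\varepsilon}-u_1\|_{L^2}\to0\qquad(\varepsilon\to0),$$ the net $(u_\varepsilon)_\varepsilon$ of solutions of $$\partial_t^2u_\varepsilon+\mathcal L^su_\varepsilon+a_\varepsilon u_\varepsilon+b_\varepsilon\partial_tu_\varepsilon=0,\quad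 u_\varepsilon(0,\cdot)=u_{0,\varepsilon},\ \partial_tu_\varepsilon(0,\cdot)=u_{1,\varepsilon},\quad u_\varepsilon(t,0)=u_\varepsilon(t,1)=0$$ on $[0,T]\times(0,1)$ converges to $u$ in $L^2$ as $\varepsilon\to0$, i.e. $\|u_\varepsilon(t,\cdot)-u(t,\cdot)\|_{L^2(0,1)}\to0$ for every $t\in[0,T]$.
   Context: **Operator.** For real $q\in L^\infty(0,1)$, $\mathcal L y=-y''+qy$ with $y(0)=y(1)=0$ is self-adjoint in $L^2(0,1)$; $\lambda_n$, $\phi_n$ ($n\ge1$) denote its eigenvalues and an orthonormal basis of $L^2(0,1)$ of real eigenfunctions. All $\lambda_n$ are positive. For $s\in\mathbb R$, $\mathcal L^s\phi_n=\lambda_n^s\phi_n$ for all $n$, i.e. $\mathcal L^sf=\sum_n\lambda_n^sf_n\phi_n$, $f_n=\int_0^1f\phi_n\,dx$. **Sobolev spaces.** $C^\infty_{\mathcal L}(0,1)=\bigcap_m\mathrm{Dom}(\mathcal L^m)$ with the norms $\max_{j\le m}\|\mathcal L^j\phi\|_{L^2}$; $\mathcal D'_{\mathcal L}(0,1)$ is its continuous dual; $W^s_{\mathcal L}(0,1)=\{f\in\mathcal D'_{\mathcal L}(0,1):\mathcal L^{s/2}f\in L^2(0,1)\}$ with norm $\|f\|_{W^s_{\mathcal L}}=\|\mathcal L^{s/2}f\|_{L^2}$. **Solutions.** Solutions (of the original and of the regularised problems) lie in $C([0,T];W^s_{\mathcal L}(0,1))\cap C^1([0,T];L^2(0,1))$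 and the equation is read through eigenfunction coefficients: for every $n$, $u_n(t)=\int_0^1u(t,x)\phi_n(x)dx$ is twice differentiable with $u_n''+\lambda_n^su_n+\int_0^1(au+bu_t)\phi_n\,dx=0$ and the corresponding initial data; the Dirichlet conditions are encoded in the $\phi_n$. The net $(u_\varepsilon)$ is the very weak solution associated with the chosen regularising families. *)

(* Defs.v *)
From HB Require Import structures.
From mathcomp Require Import all_boot all_order all_algebra.
From mathcomp Require Import all_classical all_reals all_analysis.
From mathcomp Require Import complex.

Set Implicit Arguments.
Unset Strict Implicit.
Unset Printing Implicit Defensive.

Import Order.TTheory GRing.Theory Num.Theory.
Import numFieldNormedType.Exports.

Local Open Scope classical_set_scope.
Local Open Scope ring_scope.
Local Open Scope complex_scope.

(* Functions on (0,1) are represented by functions on R, of which only the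
   almost-everywhere class on ]0, 1[ matters (all integrals and norms below are
   with respect to Lebesgue measure restricted to ]0, 1[).  The coefficients
   q, a, b and the eigenfunctions are real-valued; L^2(0,1), the Sobolev spaces
   and the solutions are complex-valued. *)
Definition leb01 (R : realType) : {measure set measurableTypeR R -> \bar R} :=
  mrestr (@lebesgue_measure R) (measurable_itv `]0%R, 1%R[).

Section FunctionSpaces.
Variable R : realType.
Implicit Types f g : R -> R[i].

Definition Linfty (a : R -> R) : Prop := a \in Lfun (leb01 R) +oo%E.

Definition normLinfty (a : R -> R) : \bar R := 'N[leb01 R]_+oo[EFin \o a]%E.

Definition ae_ge0 (a : R -> R) : Prop := \forall x \ae leb01 R, 0 <= a x.

Definition ae_eqC f g : Prop := \forall x \ae leb01 R, f x = g x.

Definition L2C f : Prop :=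
  (fun x => complex.Re (f x)) \in Lfun (leb01 R) 2%:E /\
  (fun x => complex.Im (f x)) \in Lfun (leb01 R) 2%:E.

Definition normL2 f : \bar R :=
  'N[leb01 R]_2%:E[EFin \o (fun x => ComplexField.Normc.normc (f x))]%E.

Definition intC (D : set R) f : R[i] :=
  (\int[leb01 R]_(x in D) complex.Re (f x)) +i* (\int[leb01 R]_(x in D) complex.Im (f x)).

End FunctionSpaces.

Section SturmLiouville.
Variables (R : realType) (q : R -> R).
Implicit Types (y f g : R -> R[i]) (m : nat).

(* y is absolutely continuous on [0,1], with derivative g in L^2(0,1). *)
Definition ac_deriv y g : Prop :=
  L2C g /\ forall x, 0 <= x <= 1 -> y x = y 0 + intC `[0, x] g.

(* y \in Dom(L) and L y = f: the class of y has a representative y0 in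
   H^2(0,1) that vanishes at 0 and 1, and f = - y0'' + q y0. *)
Definition SL_graph y f : Prop :=
  L2C y /\ L2C f /\
  exists y0 y1 y2 : R -> R[i],
    [/\ ae_eqC y y0, ac_deriv y0 y1, ac_deriv y1 y2, y0 0 = 0 /\ y0 1 = 0 &
        ae_eqC f (fun x => - y2 x + (q x)%:C * y0 x)].

(* y \in Dom(L^m) and L^m y = f *)
Fixpoint SLpow_graph m y f : Prop :=
  if m is k.+1 then exists2 z, SL_graph y z & SLpow_graph k z f
  else L2C y /\ L2C f /\ ae_eqC y f.

Definition SLpow m y : R -> R[i] := xget (fun=> 0) [set f | SLpow_graph m y f].

(* The space C^\infty_L(0,1). *)
Definition test_fun y : Prop := forall m, exists f, SLpow_graph m y f.

Definition test_norm m y : \bar R :=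
  \big[maxe/0%E]_(j < m.+1) normL2 (SLpow j y).

(* The space D'_L(0,1): linear functionals on C^\infty_L(0,1) that are
   continuous for the (increasing) family of norms test_norm m.  The values of
   w outside C^\infty_L(0,1) are irrelevant. *)
Definition distribution_SL (w : (R -> R[i]) -> R[i]) : Prop :=
  (forall (c : R[i]) f g, test_fun f -> test_fun g ->
     w (fun x => c * f x + g x) = c * w f + w g) /\
  exists m (K : R), forall f, test_fun f ->
     ((ComplexField.Normc.normc (w f))%:E <= K%:E * test_norm m f)%E.

(* The distribution defined by a function. *)
Definition dist_of f : (R -> R[i]) -> R[i] :=
  fun g => intC setT (fun x => f x * g x).

End SturmLiouville.

Section Spectral.
Variables (R : realType) (q : R -> R) (lam : nat -> R) (phi : nat -> R -> R).
Implicit Types (f g : R -> R[i]) (w : (R -> R[i]) -> R[i]).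

(* The integral of f against phi n (no conjugation: phi n is real). *)
Definition coef n f : R[i] := intC setT (fun x => f x * (phi n x)%:C).

Definition partial_sum (c : nat -> R[i]) (N : nat) : R -> R[i] :=
  fun x => \sum_(k < N) c k * (phi k x)%:C.

(* f = \sum_n c n phi n in L^2(0,1). *)
Definition expansion (c : nat -> R[i]) f : Prop :=
  (fun N => normL2 (fun x => partial_sum c N x - f x)) @ \oo --> 0%E.

(* (phi n) is an orthonormal basis of L^2(0,1) made of real eigenfunctions of
   the Dirichlet operator L, with eigenvalues (lam n); indices start at 0. *)
Record SL_eigenbasis : Prop := {
  eigen_fun : forall n,
    SL_graph q (fun x => (phi n x)%:C) (fun x => (lam n * phi n x)%:C);
  eigen_ortho : forall n m, \int[leb01 R]_x (phi n x * phi m x) = (n == m)%:R;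
  eigen_basis : forall f, L2C f -> expansion (coef ^~ f) f }.

(* L^s f = \sum_n lam_n^s f_n phi_n *)
Definition frac_pow (s : R) f : R -> R[i] :=
  xget (fun=> 0)
    [set g | L2C g /\ expansion (fun n => (lam n `^ s)%:C * coef n f) g].

(* L^s on D'_L(0,1), by duality (L^s is symmetric and maps C^\infty_L(0,1) to
   itself; it satisfies L^s phi_n = lam_n^s phi_n). *)
Definition frac_pow_dist (s : R) w : (R -> R[i]) -> R[i] :=
  fun g => w (frac_pow s g).

(* The distribution w is (given by) the L^2 function g. *)
Definition is_density w g : Prop :=
  L2C g /\ forall f, test_fun q f -> w f = dist_of g f.

Definition density w : R -> R[i] := xget (fun=> 0) [set g | is_density w g].

Definition W_dist (s : R) w : Prop :=
  distribution_SL q w /\ exists g, is_density (frac_pow_dist (s / 2) w) g.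

Definition normW_dist (s : R) w : \bar R :=
  normL2 (density (frac_pow_dist (s / 2) w)).

(* For s >= 0, W^s_L(0,1) is contained in L^2(0,1), so that its elements can be
   represented by functions. *)
Definition W_SL (s : R) f : Prop := L2C f /\ W_dist s (dist_of f).

Definition normW_SL (s : R) f : \bar R := normW_dist s (dist_of f).

End Spectral.

Section Solutions.
Variables (R : realType) (T : R).

(* u is in C([0,T]; X), where X is normed by nX *)
Definition cont_path (nX : (R -> R[i]) -> \bar R) (u : R -> R -> R[i]) : Prop :=
  forall t, 0 <= t <= T ->
    nX (fun x => u r x - u t x) @[r --> within `[0, T] (nbhs t)] --> 0%E.

(* u has time derivative v on [0,T] (one-sided at 0 and T), in the norm of
   L^2(0,1). *)
Definition deriv_path (u v : R -> R -> R[i]) : Prop :=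
  forall t, 0 <= t <= T ->
    normL2 (fun x => ((r - t)^-1)%:C * (u r x - u t x) - v t x)
      @[r --> within `[0, T] (dnbhs t)] --> 0%E.

(* The same for scalar functions. *)
Definition deriv_scal (c d : R -> R[i]) : Prop :=
  forall t, 0 <= t <= T ->
    ComplexField.Normc.normc (((r - t)^-1)%:C * (c r - c t) - d t)
      @[r --> within `[0, T] (dnbhs t)] --> (0 : R).

Variables (q : R -> R) (lam : nat -> R) (phi : nat -> R -> R) (s : R).

(* u is in C([0,T]; W^s_L(0,1)), it is in C^1([0,T]; L^2(0,1)) with time
   derivative ut, and it solves u_tt + L^s u + a u + b u_t = 0 with
   u(0) = u0 and u_t(0) = u1. *)
Definition solution_with (a b : R -> R) (u0 u1 : R -> R[i])
    (u ut : R -> R -> R[i]) : Prop :=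
  [/\ (forall t, 0 <= t <= T -> W_SL q lam phi s (u t)) /\
      cont_path (normW_SL q lam phi s) u,
      (forall t, 0 <= t <= T -> L2C (ut t)) /\
      deriv_path u ut /\ cont_path (@normL2 R) ut,
      ae_eqC (u 0) u0, ae_eqC (ut 0) u1 &
      forall n, exists c1 c2 : R -> R[i],
        [/\ deriv_scal (fun t => coef phi n (u t)) c1, deriv_scal c1 c2 &
            forall t, 0 <= t <= T ->
              c2 t + (lam n `^ s)%:C * coef phi n (u t)
              + coef phi n (fun x => (a x)%:C * u t x + (b x)%:C * ut t x)
              = 0]].

Definition solution (a b : R -> R) (u0 u1 : R -> R[i])
    (u : R -> R -> R[i]) : Prop :=
  exists ut, solution_with a b u0 u1 u ut.

End Solutions.

(* Main.v *)
Require Import Defs.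
From mathcomp Require Import all_boot all_order all_algebra.
From mathcomp Require Import all_classical all_reals all_analysis.
From mathcomp Require Import measurable_realfun ess_sup_inf complex.
From mathcomp Require Import ring lra.

(** The difference w = u_eps - u solves an equation of the same kind with source
    (a_eps - a) u + (b_eps - b) u_t, where u and u_t are bounded in L^2 on [0, T]
    independently of eps.  Its energy, the sum over n of
    |w_n'|^2 + (lam_n^s + 1) |w_n|^2, is small at time 0 and grows at most
    exponentially, at a rate that depends only on a common bound for a_eps and
    b_eps; hence it tends to 0 with eps.  Because the operator and the coefficients
    are real, the real and imaginary parts of the solutions are treated separately
    ([solution_part]).

    The equations are only known mode by mode, so the energy is estimated on
    finitely many modes ([energy_bound]), uniformly in their number; Bessel's
    inequality bounds the coefficients of the source, and Parseval's identity
    recovers the L^2 norms ([real_stability]).  Growth is controlled by comparison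
    with c exp(kappa t), where kappa is so large that the source, measured in the
    weighted supremum of the norms, contributes only half of that supremum.

    At time 0 the data are close in the Sobolev norm, whose square is the sum of
    lam_n^s |w_n|^2 ([W_difference]), while the energy also contains the sum of
    |w_n|^2.  The two are comparable because the eigenvalues stay away from 0
    ([spectral_gap]): positivity of each lam_n is not enough by itself, and
    accumulation at 0 is excluded by the pointwise bound
    |y| <= 2 ||y''||_{L^2} for functions that vanish at both ends. *)

Set Implicit Arguments.
Unset Strict Implicit.

Import Order.TTheory GRing.Theory Num.Theory.
Import numFieldNormedType.Exports.

Local Open Scope classical_set_scope.
Local Open Scope ring_scope.

(** * Real square-integrable functions *)

Section L2.
Context {d : measure_display} {X : measurableType d} {R : realType}.
Variable mu : {measure set X -> \bar R}.
Implicit Types (f g h : X -> R) (c : R).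

Notation L2 f := (f \in Lfun mu 2%:E).

(** The inner product of real functions, meaningful on L^2. *)
Definition ip f g : R := (\int[mu]_x (f x * g x))%R.

(** The almost-everywhere filters of a measure are monotone; stating this for a
    fixed measure keeps the measurable structure of the carrier explicit. *)
Lemma ae_imp (P Q : X -> Prop) : (forall x, P x -> Q x) ->
  (\forall x \ae mu, P x) -> \forall x \ae mu, Q x.
Proof. exact: filterS. Qed.

Lemma ae_imp2 (P Q S : X -> Prop) : (forall x, P x -> Q x -> S x) ->
  (\forall x \ae mu, P x) -> (\forall x \ae mu, Q x) -> \forall x \ae mu, S x.
Proof. exact: filterS2. Qed.

Lemma L2_measurable f : L2 f -> measurable_fun setT f.
Proof. by case/andP => /[!inE]. Qed.

Lemma L2_of_sqr f : measurable_fun setT f ->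
  (\int[mu]_x (f x ^+ 2)%:E < +oo)%E -> L2 f.
Proof.
move=> mf fo; apply/andP; split; first by rewrite inE.
rewrite inE /= /finite_norm unlock poweR_lty//.
rewrite (_ : (\int[mu]_x _)%E = (\int[mu]_x (f x ^+ 2)%:E)%E)//.
by apply: eq_integral => x _; rewrite /= powR_mulrn// real_normK// num_real.
Qed.

Lemma ip_integrable f g : L2 f -> L2 g ->
  mu.-integrable setT (EFin \o (fun x => f x * g x)).
Proof. by move=> lf lg; apply/Lfun1_integrable; exact: Lfun2_mul_Lfun1. Qed.

Lemma L2D f g : L2 f -> L2 g -> L2 (fun x => f x + g x).
Proof.
move=> lf lg; have l12 : (1 <= 2%:E :> \bar R)%E by rewrite lee1n.
exact: (@Lfun_addr_closed _ _ _ mu _ l12).2.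
Qed.

Lemma L2Z c f : L2 f -> L2 (fun x => c * f x).
Proof.
move=> lf; rewrite (_ : (fun x => _) = c \o* f); last first.
  by apply/funext => x /=; rewrite mulrC.
by apply: Lfun_scale => //; rewrite ler1n.
Qed.

Lemma L2N f : L2 f -> L2 (fun x => - f x).
Proof.
move=> /(L2Z (-1)); rewrite (_ : (fun x => _) = (fun x => - f x))//.
by apply/funext => x; rewrite mulN1r.
Qed.

Lemma L2B f g : L2 f -> L2 g -> L2 (fun x => f x - g x).
Proof. by move=> lf lg; apply: L2D => //; exact: L2N. Qed.

Lemma L2_0 : L2 (fun=> 0).
Proof.
apply: L2_of_sqr; first exact: measurable_cst.
by under eq_integral do rewrite expr0n /=; rewrite integral0 ltry.
Qed.

Lemma L2_sum (I : Type) (r : seq I) (F : I -> X -> R) :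
  (forall i, L2 (F i)) -> L2 (fun x => \sum_(i <- r) F i x).
Proof.
move=> lF; elim: r => [|i r IH].
  rewrite (_ : (fun x => _) = fun=> 0); first exact: L2_0.
  by apply/funext => x; rewrite big_nil.
rewrite (_ : (fun x => _) = (fun x => F i x + \sum_(i <- r) F i x)).
  exact: L2D.
by apply/funext => x; rewrite big_cons.
Qed.

Lemma ipC f g : ip f g = ip g f.
Proof. by apply: eq_Rintegral => x _; rewrite mulrC. Qed.

Lemma ipDl f g h : L2 f -> L2 g -> L2 h ->
  ip (fun x => f x + g x) h = ip f h + ip g h.
Proof.
move=> lf lg lh; rewrite /ip -RintegralD//; try exact: ip_integrable.
by apply: eq_Rintegral => x _; rewrite mulrDl.
Qed.

Lemma ipZl c f h : L2 f -> L2 h -> ip (fun x => c * f x) h = c * ip f h.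
Proof.
move=> lf lh; rewrite /ip -RintegralZl//; last exact: ip_integrable.
by apply: eq_Rintegral => x _; rewrite mulrA.
Qed.

Lemma ipNl f h : L2 f -> L2 h -> ip (fun x => - f x) h = - ip f h.
Proof.
move=> lf lh; rewrite -mulN1r -ipZl//.
by apply: eq_Rintegral => x _; rewrite mulN1r.
Qed.

Lemma ipBl f g h : L2 f -> L2 g -> L2 h ->
  ip (fun x => f x - g x) h = ip f h - ip g h.
Proof. by move=> lf lg lh; rewrite ipDl ?ipNl//; exact: L2N. Qed.

Lemma ipDr f g h : L2 f -> L2 g -> L2 h ->
  ip h (fun x => f x + g x) = ip h f + ip h g.
Proof. by move=> lf lg lh; rewrite ipC ipDl// !(ipC h). Qed.

Lemma ipZr c f h : L2 f -> L2 h -> ip h (fun x => c * f x) = c * ip h f.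
Proof. by move=> lf lh; rewrite ipC ipZl// (ipC h). Qed.

Lemma ipNr f h : L2 f -> L2 h -> ip h (fun x => - f x) = - ip h f.
Proof. by move=> lf lh; rewrite ipC ipNl// (ipC h). Qed.

Lemma ip0l h : ip (fun=> 0) h = 0.
Proof.
rewrite /ip /Rintegral (_ : (\int[mu]_x _)%E = 0%E)//.
by under eq_integral do rewrite mul0r; rewrite integral0.
Qed.

Lemma ip_suml (I : Type) (r : seq I) (F : I -> X -> R) h :
  (forall i, L2 (F i)) -> L2 h ->
  ip (fun x => \sum_(i <- r) F i x) h = \sum_(i <- r) ip (F i) h.
Proof.
move=> lF lh; elim: r => [|i r IH].
  rewrite big_nil -[RHS](ip0l h); congr (ip _ h).
  by apply/funext => x; rewrite big_nil.
rewrite big_cons -IH -ipDl//; last exact: L2_sum.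
by congr (ip _ h); apply/funext => x; rewrite big_cons.
Qed.

Lemma ip_ge0 f : 0 <= ip f f.
Proof. by apply: Rintegral_ge0 => x _; rewrite -expr2 sqr_ge0. Qed.

Lemma ae_eq_ip f f' g g' : L2 f -> L2 f' -> L2 g -> L2 g' ->
  (\forall x \ae mu, f x = f' x) -> (\forall x \ae mu, g x = g' x) ->
  ip f g = ip f' g'.
Proof.
move=> lf lf' lg lg' ff gg; congr fine; apply: ae_eq_integral => //.
- by case/integrableP: (ip_integrable lf lg).
- by case/integrableP: (ip_integrable lf' lg').
- by apply: filterS2 ff gg => x -> ->.
Qed.

(** Domination in L^2, stated with squares to avoid absolute values. *)
Lemma L2_le c f g : measurable_fun setT f -> L2 g ->
  (\forall x \ae mu, f x ^+ 2 <= c * g x ^+ 2) ->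
  L2 f /\ ip f f <= c * ip g g.
Proof.
move=> mf lg fg.
have mg := L2_measurable lg.
have ig : mu.-integrable setT (EFin \o (fun x => c * g x ^+ 2)).
  rewrite (_ : _ \o _ = (fun x => c%:E * (EFin \o (fun x => g x ^+ 2)%R) x)%E)//.
  by apply: integrableZl => //; apply: Lfun2_integrable_sqr.
have le1 : (\int[mu]_x (f x ^+ 2)%:E <= \int[mu]_x (`|c * g x ^+ 2|)%:E)%E.
  apply: ae_ge0_le_integral => //.
  - by move=> x _; rewrite lee_fin sqr_ge0.
  - by apply/measurable_EFinP; exact: measurable_funX.
  - by case/integrableP: (integrable_norm ig).
  - by apply: filterS fg => x h _; rewrite lee_fin (le_trans h)// ler_norm.
have lf : L2 f.
  apply: L2_of_sqr => //; apply: (le_lt_trans le1).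
  by case/integrableP: ig.
split => //.
rewrite -RintegralZl//; last by exact: ip_integrable.
rewrite /ip /Rintegral.
have e1 (h : X -> R) : L2 h ->
   (\int[mu]_x (h x * h x)%:E)%E \is a fin_num.
  by move=> lh; apply: integrable_fin_num => //; exact: ip_integrable.
have -> : (\int[mu]_x (c * (g x * g x))%:E)%E = (\int[mu]_x (c * g x ^+ 2)%:E)%E.
  by apply: eq_integral => x _; rewrite expr2.
apply: fine_le; first exact: e1.
  exact: integrable_fin_num.
have -> : (\int[mu]_x (f x * f x)%:E)%E = (\int[mu]_x (f x ^+ 2)%:E)%E.
  by apply: eq_integral => x _; rewrite expr2.
have cg0 : \forall x \ae mu, 0 <= c * g x ^+ 2.
  by apply: filterS fg => x; apply: le_trans; exact: sqr_ge0.
have -> : (\int[mu]_x (c * g x ^+ 2)%:E)%E = (\int[mu]_x (`|c * g x ^+ 2|)%:E)%E.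
  apply: ae_eq_integral => //.
  - by case/integrableP: ig.
  - by case/integrableP: (integrable_norm ig).
  - by apply: filterS cg0 => x h _ /=; rewrite ger0_norm.
exact: le1.
Qed.

Lemma ip_sqrD f g : L2 f -> L2 g ->
  ip (fun x => f x + g x) (fun x => f x + g x) = ip f f + 2 * ip f g + ip g g.
Proof.
move=> lf lg; have lfg := L2D lf lg.
by rewrite ipDl// !ipDr// (ipC g f); ring.
Qed.

Lemma cauchy_schwarz f g : L2 f -> L2 g -> ip f g ^+ 2 <= ip f f * ip g g.
Proof.
move=> lf lg.
have h c : 0 <= ip f f + 2 * c * ip f g + c ^+ 2 * ip g g.
  have lc := L2Z c lg.
  have := ip_ge0 (fun x => f x + c * g x).
  by rewrite ip_sqrD// ipZl// !ipZr// !mulrA expr2.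
have gg := ip_ge0 g; have ff := ip_ge0 f.
have [g0|g0] := eqVneq (ip g g) 0.
  have [->|fg0] := eqVneq (ip f g) 0; first by rewrite expr0n mulr_ge0.
  have := h (- (ip f f + 1) / (2 * ip f g)).
  rewrite g0 (_ : _ + _ = -1); last by field.
  by rewrite ler0N1.
have {}gg : 0 < ip g g by rewrite lt_def g0.
have := h (- ip f g / ip g g).
have -> : ip f f + 2 * (- ip f g / ip g g) * ip f g + (- ip f g / ip g g) ^+ 2 * ip g g
  = ip f f - ip f g ^+ 2 / ip g g by field.
by rewrite subr_ge0 ler_pdivrMr.
Qed.

Lemma ip_sqrD_le f g : L2 f -> L2 g ->
  ip (fun x => f x + g x) (fun x => f x + g x) <= 2 * ip f f + 2 * ip g g.
Proof.
move=> lf lg; have lfg := L2D lf lg.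
have := ip_ge0 (fun x => f x - g x); have ln := L2N lg; rewrite !ip_sqrD//.
by rewrite ipNl// !ipNr//; lra.
Qed.

End L2.

(** * Orthonormal families *)

Section Orthonormal.
Context {d : measure_display} {X : measurableType d} {R : realType}.
Variable mu : {measure set X -> \bar R}.
Implicit Types (f g h : X -> R) (c : nat -> R).
Notation L2 f := (f \in Lfun mu 2%:E).

Variable phi : nat -> X -> R.
Hypothesis phiL2 : forall n, L2 (phi n).
Hypothesis phi_ortho : forall n m, ip mu (phi n) (phi m) = (n == m)%:R.

Lemma ip_lincomb_basis (r : seq nat) c m : uniq r -> 
  ip mu (fun x => \sum_(k <- r) c k * phi k x) (phi m) = if m \in r then c m else 0.
Proof.
move=> ur; rewrite ip_suml//; last by move=> i; exact: L2Z.
under eq_bigr do rewrite ipZl// phi_ortho.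
case: ifPn => mr; last first.
  rewrite big_seq big1// => i ir; case: eqVneq => [im|]; rewrite ?mulr0//.
  by rewrite -im ir in mr.
rewrite (bigD1_seq m)//= eqxx mulr1 big1 ?addr0// => i /negbTE->.
by rewrite mulr0.
Qed.

Lemma ip_lincomb (r : seq nat) c : uniq r -> 
  ip mu (fun x => \sum_(k <- r) c k * phi k x) (fun x => \sum_(k <- r) c k * phi k x)
  = \sum_(k <- r) c k ^+ 2.
Proof.
move=> ur; rewrite {1}ip_suml; first last.
- by apply: L2_sum => k; exact: L2Z.
- by move=> k; exact: L2Z.
rewrite big_seq [RHS]big_seq; apply: eq_bigr => k kr.
rewrite ipZl//; last by apply: L2_sum => k'; exact: L2Z.
by rewrite ipC ip_lincomb_basis// kr expr2.
Qed.

(** Pythagoras: the squared distance from f to its partial expansion. *)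
Lemma ip_sub_projection f N : L2 f ->
  let P := fun x => \sum_(k < N) ip mu f (phi k) * phi k x in
  ip mu (fun x => P x - f x) (fun x => P x - f x) =
  ip mu f f - \sum_(k < N) ip mu f (phi k) ^+ 2.
Proof.
move=> lf P; pose c k := ip mu f (phi k).
have PE : P = fun x => \sum_(k <- index_iota 0 N) c k * phi k x.
  by apply/funext => x; rewrite big_mkord.
have lP : L2 P by rewrite PE; apply: L2_sum => k; exact: L2Z.
have ln := L2N lf.
rewrite ip_sqrD// ipNl// !ipNr// opprK.
have -> : ip mu P f = \sum_(k < N) c k ^+ 2.
  rewrite PE ip_suml//; last by move=> k; exact: L2Z.
  rewrite big_mkord; apply: eq_bigr => k _.
  by rewrite ipZl// ipC expr2.
have -> : ip mu P P = \sum_(k < N) c k ^+ 2.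
  by rewrite PE ip_lincomb ?iota_uniq// big_mkord.
by rewrite /c; ring.
Qed.

Lemma bessel f N : L2 f -> \sum_(k < N) ip mu f (phi k) ^+ 2 <= ip mu f f.
Proof.
by move=> lf; rewrite -subr_ge0 -ip_sub_projection//; exact: ip_ge0.
Qed.

End Orthonormal.

(** * Lebesgue measure on the unit interval *)

Section UnitInterval.
Context {R : realType}.
Notation mu := (leb01 R).
Notation L2 f := (f \in Lfun mu 2%:E).
Implicit Types (f g : measurableTypeR R -> R).

Lemma leb01_setT : leb01 R setT = 1%E.
Proof.
rewrite /leb01 /= /mrestr setTI lebesgue_measure_itv /= lte01.
by rewrite sube0.
Qed.

Lemma ip_cst1 : ip mu (fun _ => 1) (fun _ => 1) = 1.
Proof. by rewrite /ip Rintegral_cst// leb01_setT mulr1 mul1r. Qed.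

Lemma L2_1 : L2 (fun _ : measurableTypeR R => 1).
Proof.
apply: L2_of_sqr; first exact: measurable_cst.
by rewrite integral_cst// leb01_setT mule1 ltry.
Qed.

Lemma L2_leb01_bounded f (M : R) : measurable_fun setT f ->
  (\forall x \ae mu, f x ^+ 2 <= M) -> L2 f /\ ip mu f f <= M.
Proof.
move=> mf fM.
have fM' : \forall x \ae mu, f x ^+ 2 <= M * 1 ^+ 2.
  by apply: ae_imp fM => x; rewrite expr1n mulr1.
by have := L2_le mf L2_1 fM'; rewrite ip_cst1 mulr1.
Qed.

(** Since the whole space has measure 1, an integral over a subset is an inner
    product with a function of norm at most 1. *)
Lemma L2_indic01 (A : set (measurableTypeR R)) : measurable A -> L2 \1_A /\ ip mu \1_A \1_A <= 1.
Proof.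
move=> mA; apply: L2_leb01_bounded.
  exact: measurable_indic.
by apply: nearW => x; rewrite indicE; case: (x \in A); rewrite ?expr1n// expr0n ler01.
Qed.

Lemma Rintegral_indic (A : set (measurableTypeR R)) f : \int[mu]_(x in A) f x = ip mu f \1_A.
Proof.
rewrite Rintegral_mkcond; apply: eq_Rintegral => x _.
by rewrite patchE indicE; case: (x \in A); rewrite ?mulr1 ?mulr0.
Qed.

Lemma Rintegral_sqr_le (A : set (measurableTypeR R)) f : measurable A -> L2 f ->
  (\int[mu]_(x in A) f x) ^+ 2 <= ip mu f f.
Proof.
move=> mA lf; have [lA A1] := L2_indic01 mA.
rewrite Rintegral_indic (le_trans (cauchy_schwarz lf lA))//.
by rewrite ler_piMr// ip_ge0.
Qed.

Lemma ae_leb01 (P : measurableTypeR R -> Prop) :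
  (forall x, 0 < x < 1 -> P x) -> \forall x \ae mu, P x.
Proof.
move=> h; have mI : measurable (`]0%R, 1%R[%classic : set (measurableTypeR R)).
  exact: measurable_itv.
exists (~` `]0%R, 1%R[); split; first exact: measurableC.
  by rewrite /leb01 /= /mrestr setICl measure0.
by move=> x /= nP; rewrite in_itv /= => x01; apply: nP; exact: h.
Qed.

(** An essentially bounded function is bounded almost everywhere by its norm. *)
Lemma Linfty_bound (a : R -> R) : Linfty a ->
  exists2 A : R, 0 <= A /\ normLinfty a = A%:E & \forall x \ae mu, a x ^+ 2 <= A ^+ 2.
Proof.
case/andP; rewrite !inE/= /finite_norm => ma.
have -> : 'N[mu]_+oo[EFin \o a]%E = normLinfty a by [].
have a0 : (0 <= normLinfty a)%E by exact: Lnorm_ge0.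
move=> afin.
have [a1 aE] : (0 <= fine (normLinfty a)) /\ normLinfty a = (fine (normLinfty a))%:E.
  by split; [exact: fine_ge0|rewrite fineK// ge0_fin_numE].
exists (fine (normLinfty a)) => //.
have : \forall x \ae mu, ((abse \o (EFin \o a)) x <= normLinfty a)%E.
  have -> : normLinfty a = ess_sup mu (abse \o (EFin \o a)).
    by rewrite /normLinfty unlock /= leb01_setT lte01.
  exact: ess_sup_ge.
apply: ae_imp => x; rewrite aE /= lee_fin => h.
by rewrite -[leLHS]real_normK ?num_real// ler_sqr ?nnegrE.
Qed.

(** A pointwise bound on a sum of squares bounds the sum of the squared norms. *)
Lemma sum_ip_le (r : seq nat) (F : nat -> measurableTypeR R -> R) (C : R) :
  (forall k, L2 (F k)) ->
  (\forall x \ae mu, \sum_(k <- r) F k x ^+ 2 <= C) ->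
  \sum_(k <- r) ip mu (F k) (F k) <= C.
Proof.
move=> lF hC; pose S (x : measurableTypeR R) := \sum_(k <- r) F k x ^+ 2.
have S0 x : 0 <= S x by apply: sumr_ge0 => k _; exact: sqr_ge0.
have mS : measurable_fun setT S.
  by apply: measurable_sum => k; apply: measurable_funX; exact: L2_measurable (lF k).
have hS x : (S x `^ 2^-1) ^+ 2 = S x by rewrite powR12_sqrt// sqr_sqrtr.
have mh : measurable_fun setT (fun x => S x `^ 2^-1).
  exact: (measurableT_comp (measurable_powR _) mS).
have [|_] := @L2_leb01_bounded _ C mh.
  by apply: ae_imp hC => x; rewrite hS.
apply: le_trans; rewrite /ip.
under [leRHS]eq_Rintegral do rewrite -expr2 hS.
rewrite /Rintegral.
have -> : (\int[mu]_x (S x)%:E)%E = (\sum_(k <- r) \int[mu]_x (F k x * F k x)%:E)%E.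
  rewrite -(@integral_sum _ _ _ _ _ _ _ (fun k x => (F k x * F k x)%:E))//.
    by apply: eq_integral => x _; rewrite sumEFin.
  by move=> k; exact: ip_integrable.
rewrite sum_fine//.
by move=> k _; apply: integrable_fin_num => //; exact: ip_integrable.
Qed.

Lemma L2_mul_bounded (A : R) f g : measurable_fun setT f ->
  (\forall x \ae mu, f x ^+ 2 <= A) -> L2 g ->
  L2 (fun x => f x * g x) /\ 
  ip mu (fun x => f x * g x) (fun x => f x * g x) <= A * ip mu g g.
Proof.
move=> mf fA lg; apply: L2_le => //.
  by apply: measurable_funM => //; exact: L2_measurable lg.
by apply: ae_imp fA => x fx; rewrite exprMn ler_wpM2r// sqr_ge0.
Qed.

End UnitInterval.

(** * Functions in H^2 with Dirichlet conditions *)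

Section SpectralGap.
Context {R : realType}.
Notation mu := (leb01 R).
Notation L2 f := (f \in Lfun mu 2%:E).

(** The function y0 belongs to H^2(0,1) and vanishes at both ends, with
    derivatives y1 and y2 in the sense of absolute continuity: the value at 0
    is built into the formula for y0. *)
Record H2_dirichlet (y0 y1 y2 : R -> R) : Prop := {
  H2_L2_1 : L2 (y1 : measurableTypeR R -> R);
  H2_L2_2 : L2 (y2 : measurableTypeR R -> R);
  H2_prim0 : forall x, 0 <= x <= 1 -> y0 x = \int[mu]_(t in `[0, x]) y1 t;
  H2_prim1 : forall x, 0 <= x <= 1 -> y1 x = y1 0 + \int[mu]_(t in `[0, x]) y2 t;
  H2_end : y0 1 = 0 }.

Lemma H2_dirichlet_lincomb (r : seq nat) (c : nat -> R) (Y0 Y1 Y2 : nat -> R -> R) :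
  (forall k, H2_dirichlet (Y0 k) (Y1 k) (Y2 k)) ->
  H2_dirichlet (fun x => \sum_(k <- r) c k * Y0 k x)
    (fun x => \sum_(k <- r) c k * Y1 k x) (fun x => \sum_(k <- r) c k * Y2 k x).
Proof.
move=> hY.
have mI (x : R) : measurable (`[0%R, x] : set (measurableTypeR R)) by exact: measurable_itv.
have lI x := (L2_indic01 (mI x)).1.
have intE (F : nat -> R -> R) x : (forall k, L2 (F k : measurableTypeR R -> R)) ->
  \int[mu]_(t in `[0, x]) (\sum_(k <- r) c k * F k t) =
  \sum_(k <- r) c k * \int[mu]_(t in `[0, x]) F k t.
  move=> lF; rewrite Rintegral_indic ip_suml//; last by move=> k; exact: L2Z.
  by apply: eq_bigr => k _; rewrite ipZl// Rintegral_indic.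
have l1 k := H2_L2_1 (hY k); have l2 k := H2_L2_2 (hY k).
split.
- by apply: L2_sum => k; exact: L2Z.
- by apply: L2_sum => k; exact: L2Z.
- move=> x x01; rewrite intE//; apply: eq_bigr => k _.
  by rewrite (H2_prim0 (hY k)).
- move=> x x01; rewrite intE// -big_split; apply: eq_bigr => k _ /=.
  by rewrite (H2_prim1 (hY k) x01) mulrDr.
- by apply: big1 => k _; rewrite (H2_end (hY k)) mulr0.
Qed.

(** A function of H^2(0,1) that vanishes at both ends is bounded by twice the
    norm of its second derivative.  Indeed y1 differs from y1 0 by at most that
    norm, and y1 has mean 0. *)
Lemma H2_dirichlet_sup y0 y1 y2 x : H2_dirichlet y0 y1 y2 -> 0 <= x <= 1 ->
  y0 x ^+ 2 <= 4 * ip mu y2 y2.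
Proof.
move=> [l1 l2 p0 p1 e1] x01.
have mI (t : R) : measurable (`[0%R, t] : set (measurableTypeR R)) by exact: measurable_itv.
set M := ip mu y2 y2.
have le2 t : 0 <= t <= 1 -> (y1 t - y1 0) ^+ 2 <= M.
  by move=> t01; rewrite p1// addrC addKr; exact: Rintegral_sqr_le.
have lc : L2 (fun _ : measurableTypeR R => y1 0).
  have := L2Z (y1 0) (@L2_1 R); rewrite (_ : (fun _ => _) = fun=> y1 0)//.
  by apply/funext => t; rewrite mulr1.
have lz := L2B l1 lc.
have zM : ip mu (fun t => y1 t - y1 0) (fun t => y1 t - y1 0) <= M.
  apply: (L2_leb01_bounded (L2_measurable lz) _).2.
  by apply: ae_leb01 => t /andP[t0 t1]; apply: le2; rewrite !ltW.
have y10 : y1 0 ^+ 2 <= M.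
  have := p0 1; rewrite ler01 lexx => /(_ isT); rewrite e1 => /esym I0.
  have [lI _] := L2_indic01 (mI 1).
  have I1 : ip mu (fun _ : measurableTypeR R => 1) \1_(`[0%R, 1] : set R) = 1.
    rewrite -[RHS]ip_cst1; apply: ae_eq_ip => //; try exact: L2_1.
      exact: nearW.
    apply: ae_leb01 => t t01; rewrite indicE mem_set//=.
    by case/andP: t01 => t0 t1; rewrite in_itv /= !ltW.
  have := Rintegral_sqr_le (mI 1) lz; rewrite Rintegral_indic ipBl//.
  (* the mean of y1 - y1 0 is - y1 0, because the mean of y1 is y0 1 = 0 *)
  rewrite -Rintegral_indic I0 sub0r sqrrN.
  rewrite (_ : (fun=> y1 0) = (fun x => y1 0 * 1)); last first.
    by apply/funext => t; rewrite mulr1.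
  rewrite ipZl//; last exact: L2_1.
  by rewrite I1 mulr1 => /le_trans; apply.
have y1M t : 0 <= t <= 1 -> y1 t ^+ 2 <= 4 * M.
  move=> /le2; have := sqr_ge0 (y1 t - 2 * y1 0); move: y10; rewrite !expr2; nra.
have : ip mu y1 y1 <= 4 * M.
  apply: (L2_leb01_bounded (L2_measurable l1) _).2.
  by apply: ae_leb01 => t /andP[t0 t1]; apply: y1M; rewrite !ltW.
by apply: le_trans; rewrite p0//; exact: Rintegral_sqr_le.
Qed.

(** The Sturm-Liouville equation for real data, read on real parts. *)
Lemma SL_graph_real (q : R -> R) (f g : R -> R) :
  SL_graph q (fun x => (f x)%:C%C) (fun x => (g x)%:C%C) ->
  exists y : (R -> R) * (R -> R) * (R -> R),
   [/\ H2_dirichlet y.1.1 y.1.2 y.2, \forall x \ae mu, f x = y.1.1 x &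
       \forall x \ae mu, g x = - y.2 x + q x * y.1.1 x].
Proof.
move=> [_ [_ [z0 [z1 [z2 [fz ac1 ac2 [z00 z01] gz]]]]]].
have ReD (u v : R[i]) : complex.Re (u + v) = complex.Re u + complex.Re v.
  by case: u v => ? ? [].
pose re (h : R -> R[i]) x := complex.Re (h x).
exists (re z0, re z1, re z2) => /=; split.
- case: ac1 ac2 => [[l1 _] e1] [[l2 _] e2]; split => //.
  + by move=> x x01; rewrite /re e1// z00 add0r.
  + by move=> x x01; rewrite /re {1}e2// ReD.
  + by rewrite /re z01.
- by move: fz; apply: ae_imp => x; rewrite /re => <-.
- move: gz; apply: ae_imp => x; rewrite /re => /(congr1 (@complex.Re R)).
  by case: (z2 x) (z0 x) => a b [c e] /= ->; rewrite mul0r subr0.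
Qed.

End SpectralGap.

(** * The eigenvalues are bounded away from zero *)

Section Gap.
Context {R : realType}.
Notation mu := (leb01 R).
Notation L2 f := (f \in Lfun mu 2%:E).
Variables (q : R -> R) (lam : nat -> R) (phi : nat -> R -> R).
Hypothesis hq : Linfty q.
Hypothesis hphi : SL_eigenbasis q lam phi.
Hypothesis lam_gt0 : forall n, 0 < lam n.

Lemma eigenfun_L2 n : L2 (phi n : measurableTypeR R -> R).
Proof. by have [[]] := eigen_fun hphi n. Qed.

Lemma eigenfun_ortho n m : ip mu (phi n) (phi m) = (n == m)%:R.
Proof. exact: (eigen_ortho hphi). Qed.

(** Only boundedly many eigenvalues are at most 1.  Let f = \sum c_k phi_k be a
    combination of the corresponding eigenfunctions: the L^2 norm of its second
    derivative is at most a constant times that of f, hence so is its sup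
    norm.  Choosing c_k = phi_k x bounds \sum phi_k(x)^2 uniformly in x, and
    integrating this sum counts the eigenfunctions. *)
Lemma low_eigenvalues_bound : exists C : R, forall r : seq nat, uniq r ->
  (forall n, n \in r -> lam n <= 1) -> (size r)%:R <= C.
Proof.
have [Q [Q0 _] qQ] := Linfty_bound hq.
have mq : measurable_fun setT (q : measurableTypeR R -> R) by case/andP: hq => /[!inE].
exists (4 * (2 * (Q ^+ 2 + 1))) => r ur lamr.
set C := 4 * _.
have [Y hY] := boolp.choice (fun n => SL_graph_real (eigen_fun hphi n)).
have lphi := eigenfun_L2.
have lC (c : nat -> R) : L2 (fun x : measurableTypeR R => \sum_(k <- r) c k * phi k x).
  by apply: L2_sum => k; exact: L2Z.
have ae_all (P : nat -> measurableTypeR R -> Prop) :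
    (forall n, \forall x \ae mu, P n x) -> \forall x \ae mu, forall n, P n x.
  by move=> hP; apply: ae_foralln.
have SC x : 0 <= x <= 1 -> \sum_(k <- r) (Y k).1.1 x ^+ 2 <= C.
  (* the coefficients of f are the values of the eigenfunctions at x, so that
     f x is their sum of squares S *)
  move=> x01; pose c k := (Y k).1.1 x.
  have hH := @H2_dirichlet_lincomb R r c (fun k => (Y k).1.1) (fun k => (Y k).1.2)
    (fun k => (Y k).2) (fun k => let: And3 h _ _ := hY k in h).
  have := H2_dirichlet_sup hH x01.
  set y2 := (fun x => \sum_(k <- r) c k * (Y k).2 x).
  have -> : \sum_(k <- r) c k * (Y k).1.1 x = \sum_(k <- r) c k ^+ 2 by [].
  set S := \sum_(k <- r) c k ^+ 2.
  have S0 : 0 <= S by apply: sumr_ge0 => k _; exact: sqr_ge0.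
  pose f (x : measurableTypeR R) := \sum_(k <- r) c k * phi k x.
  pose g (x : measurableTypeR R) := \sum_(k <- r) (- lam k * c k) * phi k x.
  (* f'' = q f + g, where g = - \sum lam_k c_k phi_k *)
  have [lqf qf] := L2_mul_bounded mq qQ (lC c).
  have y2E : \forall x \ae mu, y2 x = q x * f x + g x.
    have h1 : \forall x \ae mu, forall k, phi k x = (Y k).1.1 x.
      by apply: ae_all => k; have [] := hY k.
    have h2 : \forall x \ae mu, forall k, lam k * phi k x = - (Y k).2 x + q x * (Y k).1.1 x.
      by apply: ae_all => k; have [] := hY k.
    move: h1 h2; apply: ae_imp2 => z e1 e2.
    rewrite /y2 /f /g mulr_sumr -big_split; apply: eq_bigr => k _ /=.
    have -> : (Y k).2 z = q z * phi k z - lam k * phi k z by rewrite e2 e1; ring.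
    ring.
  have ly2 : L2 (y2 : measurableTypeR R -> R) by exact: H2_L2_2 hH.
  have -> : ip mu y2 y2 = ip mu (fun x => q x * f x + g x) (fun x => q x * f x + g x).
    by have l := L2D lqf (lC (fun k => - lam k * c k)); exact: ae_eq_ip.
  have ipf : ip mu f f = S by exact: (ip_lincomb lphi eigenfun_ortho).
  have ipg : ip mu g g <= S.
    rewrite /g (ip_lincomb lphi eigenfun_ortho)// /S big_seq [leRHS]big_seq.
    apply: ler_sum => k kr; rewrite exprMn ler_piMl ?sqr_ge0// sqrrN.
    by rewrite expr_le1// ?lamr// ltW.
  have := ip_sqrD_le lqf (lC (fun k => - lam k * c k)).
  rewrite -/f -/g => h h'.
  have SS : S ^+ 2 <= C * S.
    apply: (le_trans h'); rewrite /C -mulrA ler_wpM2l//.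
    apply: (le_trans h); rewrite -mulrA -mulrDr ler_wpM2l//.
    by rewrite mulrDl mul1r; apply: lerD => //; rewrite -ipf.
  have [->|Sn0] := eqVneq S 0.
    by rewrite /C mulr_ge0// mulr_ge0// addr_ge0// sqr_ge0.
  by move: SS; rewrite expr2 ler_pM2r// lt_def Sn0.
have -> : (size r)%:R = \sum_(k <- r) ip mu (phi k) (phi k).
  by under eq_bigr do rewrite eigenfun_ortho eqxx; rewrite big_const_seq count_predT iter_addr_0.
apply: sum_ip_le => //.
have h1 : \forall x \ae mu, forall k, phi k x = (Y k).1.1 x.
  by apply: ae_all => k; have [] := hY k.
have h2 : \forall x \ae mu, 0 <= x <= 1.
  by apply: ae_leb01 => x /andP[? ?]; rewrite !ltW.
move: h1 h2; apply: ae_imp2 => x e1 x01.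
by under eq_bigr do rewrite e1; exact: SC.
Qed.

(** Finitely many positive eigenvalues lie below 1, so they all stay above a
    positive constant. *)
Lemma spectral_gap : exists2 m : R, 0 < m & forall n, m <= lam n.
Proof.
have [C hC] := low_eigenvalues_bound.
have [N hN] : exists N : nat, forall n, (N <= n)%N -> 1 < lam n.
  apply: contrapT => /forallNP nN.
  have step N : exists2 n, (N <= n)%N & lam n <= 1.
    move/existsNP: (nN N) => [n /not_implyP[Nn /negP]].
    by rewrite -leNgt => ln; exists n.
  have hr (k : nat) : exists r : seq nat, [/\ uniq r,
      (exists N, forall n, n \in r -> (n < N)%N),
      (forall n, n \in r -> lam n <= 1) & size r = k].
    elim: k => [|k [r [ur [N rN] lr sr]]]; first by exists [::]; split => //; exists 0%N.
    have [n Nn ln] := step N; exists (n :: r); split => /=.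
    - by rewrite ur andbT; apply/negP => /rN; rewrite ltnNge Nn.
    - exists n.+1 => m; rewrite inE => /predU1P[->//|/rN mN].
      by rewrite ltnS ltnW// (leq_trans mN).
    - by move=> m; rewrite inE => /predU1P[->//|]; exact: lr.
    - by rewrite sr.
  have [r [ur _ lr sr]] := hr (Num.bound `|C|).
  have := hC _ ur lr; rewrite sr.
  by apply/negP; rewrite -ltNge (le_lt_trans (ler_norm C))// archi_boundP.
have [m m0 hm] : exists2 m : R, 0 < m & forall n, (n < N)%N -> m <= lam n.
  elim: N {hN} => [|N [m m0 hm]]; first by exists 1.
  exists (Num.min m (lam N)); first by rewrite lt_min m0 lam_gt0.
  move=> n; rewrite ltnS leq_eqVlt => /predU1P[->|/hm nm]; rewrite ge_min ?lexx ?orbT//.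
  by rewrite nm.
exists (Num.min m 1) => [|n]; first by rewrite lt_min m0 ltr01.
case: (ltnP n N) => [/hm|/hN/ltW] h; rewrite ge_min h ?orbT//.
Qed.

End Gap.

(** * Differentiation on a closed interval *)

Section RealCalculus.
Context {R : realType}.
Implicit Types (T : R) (f g : R -> R).

(** Continuity on [0, T], one-sided at the ends. *)
Definition cont_on T f := forall t, 0 <= t <= T -> forall e, 0 < e ->
  exists2 d, 0 < d & forall r, 0 <= r <= T -> `|r - t| < d -> `|f r - f t| <= e.

(** The function f has derivative g on [0, T], one-sided at the ends. *)
Definition deriv_on T f g := forall t, 0 <= t <= T -> forall e, 0 < e ->
  exists2 d, 0 < d & forall r, 0 <= r <= T -> r != t -> `|r - t| < d ->
    `|(r - t)^-1 * (f r - f t) - g t| <= e.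

Lemma cont_on_within T f : cont_on T f -> {within `[0, T], continuous f}.
Proof.
move=> cf; apply/subspace_continuousP => t /=; rewrite in_itv /= => t0T.
apply/cvgrPdist_le => e e0; rewrite near_withinE.
have [d d0 hd] := cf t t0T e e0.
apply/nbhs_ballP; exists d => //= r; rewrite /ball /= => rt.
by rewrite in_itv /= => r0T; rewrite distrC; apply: hd => //; rewrite distrC.
Qed.

Lemma cont_on_bounded T f : 0 <= T -> cont_on T f ->
  exists M, forall t, 0 <= t <= T -> f t <= M.
Proof.
move=> T0 /cont_on_within/(EVT_max T0)[c _ hc]; exists (f c) => t t0T.
by apply: hc; rewrite in_itv.
Qed.

Lemma deriv_on_cont T f g : deriv_on T f g -> cont_on T f.
Proof.
move=> fg t t0T e e0; have [d d0 hd] := fg t t0T 1 ltr01.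
have g1 : 0 < `|g t| + 1 by rewrite ltr_wpDl.
exists (Num.min d (e / (`|g t| + 1))); first by rewrite lt_min d0 divr_gt0.
move=> r r0T; rewrite lt_min => /andP[rd re].
have [->|rt] := eqVneq r t; first by rewrite subrr normr0 ltW.
have rt0 : r - t != 0 by rewrite subr_eq0.
have -> : f r - f t = (r - t) * ((r - t)^-1 * (f r - f t)) by rewrite mulVKf.
rewrite normrM; move: re; rewrite ltr_pdivlMr// => /ltW; apply: le_trans.
rewrite ler_wpM2l//.
have := hd r r0T rt rd; set x := _ * _ => h.
have -> : x = g t + (x - g t) by rewrite addrC subrK.
by rewrite (le_trans (ler_normD _ _))// lerD2l.
Qed.

Lemma deriv_on_is_derive T f g t : deriv_on T f g -> 0 < t < T ->
  is_derive t 1 f (g t).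
Proof.
move=> fg /andP[t0 tT].
suff h : (fun h => h^-1 *: ((f \o shift t) (h *: 1) - f t)) @ 0^' --> g t.
  by apply: DeriveDef; [apply/cvg_ex; exists (g t)|exact: cvg_lim h].
apply/cvgrPdist_le => e e0.
have [d d0 hd] := fg t (introT andP (conj (ltW t0) (ltW tT))) e e0.
rewrite near_withinE; apply/nbhs_ballP.
exists (Num.min d (Num.min t (T - t))) => /=; first by rewrite !lt_min d0 t0 subr_gt0.
move=> h; rewrite /ball /= sub0r normrN !lt_min => /and3P[hd' ht hT] h0.
have hE : h + t - t = h by rewrite addrK.
have := hd (h + t); rewrite hE distrC /= scaler1; apply => //.
- move: ht hT; rewrite !ltr_norml => /andP[h1 h2] /andP[h3 h4].
  by apply/andP; split; lra.
- by rewrite -subr_eq0 hE.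
Qed.

(** The function f is continuous on [0, T] and has derivative g in the interior.
    This is all that the mean value theorem needs, and it is stable under sums
    and products. *)
Definition diff_on T f g :=
  (forall t, 0 < t < T -> is_derive t 1 f (g t)) /\ {within `[0, T], continuous f}.

Lemma deriv_on_diff T f g : deriv_on T f g -> diff_on T f g.
Proof.
move=> fg; split; first by move=> t; exact: deriv_on_is_derive fg.
exact: cont_on_within (deriv_on_cont fg).
Qed.

Lemma diff_on_cst T (c : R) : diff_on T (fun=> c) (fun=> 0).
Proof. by split=> [t _|t]; [exact: is_derive_cst|exact: cvg_cst]. Qed.

Lemma diff_onD T f f' g g' : diff_on T f f' -> diff_on T g g' ->
  diff_on T (fun t => f t + g t) (fun t => f' t + g' t).
Proof.
move=> [df cf] [dg cg]; split => [t tT|t]; last by apply: cvgD; [exact: cf|exact: cg].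
by have := is_deriveD (df t tT) (dg t tT).
Qed.

Lemma diff_onM T f f' g g' : diff_on T f f' -> diff_on T g g' ->
  diff_on T (fun t => f t * g t) (fun t => f t * g' t + g t * f' t).
Proof.
move=> [df cf] [dg cg]; split => [t tT|t]; last by apply: cvgM; [exact: cf|exact: cg].
by have := is_deriveM (df t tT) (dg t tT).
Qed.

Lemma diff_on_sum T (r : seq nat) (f f' : nat -> R -> R) :
  (forall k, diff_on T (f k) (f' k)) ->
  diff_on T (fun t => \sum_(k <- r) f k t) (fun t => \sum_(k <- r) f' k t).
Proof.
move=> df; elim: r => [|k r IH].
  rewrite (_ : (fun t => _) = fun=> 0); last by apply/funext => t; rewrite big_nil.
  rewrite (_ : (fun t => \sum_(_ <- _) _) = fun=> 0); first exact: diff_on_cst.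
  by apply/funext => t; rewrite big_nil.
have := diff_onD (df k) IH; congr diff_on; apply/funext => t;
  by rewrite big_cons.
Qed.

Lemma diff_on_expR T (k : R) :
  diff_on T (fun t => expR (k * t)) (fun t => k * expR (k * t)).
Proof.
have h (t : R) : is_derive t 1 (fun t : R => expR (k * t)) (k * expR (k * t)).
  have h1 : is_derive t 1 (fun t : R => k * t) k.
    by have := is_deriveZ k (is_derive_id t 1); rewrite /GRing.scale /= mulr1.
  have := is_derive1_comp (is_derive_expR (k * t)) h1.
  by rewrite mulrC.
split; first by move=> t _.
apply: continuous_subspaceT => t; apply: differentiable_continuous.
by apply/derivable1_diffP; have [] := h t.
Qed.

Lemma diff_on_nonincr T f g : diff_on T f g ->
  (forall t, 0 <= t <= T -> g t <= 0) -> forall t, 0 <= t <= T -> f t <= f 0.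
Proof.
move=> [df cf] g0 t /andP[t0 tT].
have [||c] := @MVT_segment R f g 0 t t0.
- move=> x; rewrite in_itv /= => /andP[x0 xt]; apply: df.
  by rewrite x0 (lt_le_trans xt).
- apply: continuous_subspaceW cf => x /=; rewrite !in_itv /= => /andP[-> xt].
  exact: le_trans xt tT.
rewrite in_itv /= => /andP[c0 ct] e.
rewrite -subr_le0 e subr0 mulr_le0_ge0// g0// c0 (le_trans ct)//.
Qed.

End RealCalculus.

(** * The energy inequality *)

Section Energy.
Context {R : realType}.

(** One-sided derivatives at the ends are unique as well, since [0, T] has no
    isolated point. *)
Lemma deriv_on_unique (T : R) (f g g' : R -> R) : 0 < T ->
  deriv_on T f g -> deriv_on T f g' -> forall t, 0 <= t <= T -> g t = g' t.
Proof.
move=> T0 fg fg' t t0T; apply/eqP; rewrite -subr_eq0 -normr_le0.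
apply/ler_addgt0Pl => e e0; rewrite addr0.
have e2 : 0 < e / 2 by rewrite divr_gt0.
have [d d0 hd] := fg t t0T _ e2; have [d' d'0 hd'] := fg' t t0T _ e2.
have [r [r0T rt rd]] : exists r, [/\ 0 <= r <= T, r != t & `|r - t| < Num.min d d'].
  (* a step small enough to stay in [0, T], to the right or to the left of t *)
  pose h := Num.min (T / 2) (Num.min d d' / 2).
  have m0 : 0 < Num.min d d' by rewrite lt_min d0.
  have h0 : 0 < h by rewrite lt_min !divr_gt0.
  have hT : h <= T / 2 by rewrite ge_min lexx.
  have hm : h < Num.min d d'.
    by apply: (@le_lt_trans _ _ (Num.min d d' / 2)); [rewrite ge_min lexx orbT|lra].
  case/andP: t0T => t0 tT; case: (leP t (T / 2)) => tT2.
    exists (t + h); split; first by apply/andP; split; lra.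
      by apply/eqP; lra.
    by rewrite addrAC subrr add0r gtr0_norm.
  exists (t - h); split; first by apply/andP; split; lra.
    by apply/eqP; lra.
  by rewrite addrAC subrr add0r normrN gtr0_norm.
move: rd; rewrite lt_min => /andP[/(hd r r0T rt) + /(hd' r r0T rt)].
set x := _ * _ => h1 h2.
have -> : g t - g' t = (x - g' t) - (x - g t) by ring.
by rewrite (le_trans (ler_normB _ _))// (splitr e) lerD.
Qed.

(** Finitely many modes W_k'' + m_k W_k + F_k = 0, with V_k = W_k'.  The energy
    e = \sum (V_k^2 + (m_k + 1) W_k^2) satisfies e' <= 2 e + \sum F_k^2: the
    extra W_k^2 makes the energy control W_k without any lower bound on m_k.
    When \sum F_k^2 is at most K P exp(kappa t) + delta with kappa = 3 + 2 K,
    the energy stays below the supersolution (E0 + delta + P / 2) exp(kappa t). *)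
Lemma energy_bound (T K delta P E0 : R) (r : seq nat) (m : nat -> R)
    (W V F : nat -> R -> R) :
  0 <= K -> 0 <= delta -> 0 <= P -> 0 <= E0 -> (forall k, 0 <= m k) ->
  (forall k, diff_on T (W k) (V k)) ->
  (forall k, diff_on T (V k) (fun t => - (m k * W k t) - F k t)) ->
  (forall t, 0 <= t <= T ->
     \sum_(k <- r) F k t ^+ 2 <= K * (P * expR ((3 + 2 * K) * t)) + delta) ->
  \sum_(k <- r) (V k 0 ^+ 2 + (m k + 1) * W k 0 ^+ 2) <= E0 ->
  forall t, 0 <= t <= T ->
    \sum_(k <- r) (V k t ^+ 2 + (m k + 1) * W k t ^+ 2) <=
    (E0 + delta + P / 2) * expR ((3 + 2 * K) * t).
Proof.
move=> K0 d0 P0 E00 m0 dW dV hF e0 t t0T.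
pose e t := \sum_(k <- r) (V k t ^+ 2 + (m k + 1) * W k t ^+ 2).
pose e' t := \sum_(k <- r) (2 * (W k t * V k t) - 2 * (V k t * F k t)).
have de : diff_on T e e'.
  have h k := diff_onD (diff_onM (dV k) (dV k))
    (diff_onM (diff_on_cst T (m k + 1)) (diff_onM (dW k) (dW k))).
  have := diff_on_sum r h; congr diff_on; apply/funext => x; apply: eq_bigr => k _;
    by rewrite ?expr2; ring.
have e'e x : e' x <= 2 * e x + \sum_(k <- r) F k x ^+ 2.
  rewrite /e' /e mulr_sumr -big_split; apply: ler_sum => k _ /=.
  have := sqr_ge0 (W k x - V k x); have := sqr_ge0 (V k x + F k x).
  have : 0 <= m k * W k x ^+ 2 by rewrite mulr_ge0// sqr_ge0.
  by rewrite !expr2 => h; have := sqr_ge0 (W k x); rewrite !expr2; nra.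
set c := E0 + delta + P / 2.
have c0 : 0 <= c by rewrite !addr_ge0// divr_ge0.
(* exp(- 2 t) (e t - c exp(kappa t)) is nonincreasing, and nonpositive at 0 *)
have dH := diff_onD (diff_onM (diff_on_expR T (- 2)) de)
  (diff_onM (diff_on_cst T (- c)) (diff_on_expR T (1 + 2 * K))).
have expE x : expR ((1 + 2 * K) * x) = expR (- 2 * x) * expR ((3 + 2 * K) * x).
  by rewrite -expRD; congr expR; ring.
have := diff_on_nonincr dH _ t0T; rewrite -/(e t) !mulr0 expR0 !mul1r mulr1.
have -> : (expR (- 2 * t) * e t + - c * expR ((1 + 2 * K) * t)) =
   expR (- 2 * t) * (e t - c * expR ((3 + 2 * K) * t)) by rewrite expE; ring.
move=> H; have : expR (-2 * t) * (e t - c * expR ((3 + 2 * K) * t)) <= 0.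
  apply: (le_trans (H _)); last first.
    by rewrite subr_le0 (le_trans e0)// /c -addrA lerDl addr_ge0// divr_ge0.
  move=> {H}x x0T.
  rewrite mulr0 addr0 expE.
  set a := expR (- 2 * x); set y := expR _.
  have -> : a * e' x + e x * (-2 * a) + - c * ((1 + 2 * K) * (a * y)) =
    a * (e' x - 2 * e x - c * (1 + 2 * K) * y) by ring.
  rewrite mulr_ge0_le0 ?expR_ge0//.
  have y1 : 1 <= y.
    rewrite -expR0 ler_expR mulr_ge0//; last by case/andP: x0T.
    by rewrite addr_ge0// mulr_ge0.
  have h1 := e'e x; have h2 := hF x x0T; rewrite -/y in h2.
  have h3 : delta <= delta * y by rewrite ler_peMr.
  have h4 : 0 <= E0 * (1 + 2 * K) * y.
    by rewrite !mulr_ge0 ?addr_ge0 ?mulr_ge0// expR_ge0.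
  have h5 : 0 <= delta * K * y by rewrite !mulr_ge0// expR_ge0.
  have h6 : 0 <= P * y by rewrite mulr_ge0// expR_ge0.
  have -> : c * (1 + 2 * K) * y = E0 * (1 + 2 * K) * y + delta * y +
     2 * (delta * K * y) + P * y / 2 + K * (P * y) by rewrite /c; field.
  lra.
by rewrite pmulr_rle0 ?expR_gt0// subr_le0.
Qed.

End Energy.

(** * Stability of real-valued solutions *)

Section RealStability.
Context {R : realType}.
Notation mu := (leb01 R).
Notation L2 f := (f \in Lfun mu 2%:E).

Lemma diff_onB (T : R) (f f' g g' : R -> R) : diff_on T f f' -> diff_on T g g' ->
  diff_on T (fun t => f t - g t) (fun t => f' t - g' t).
Proof.
move=> [df cf] [dg cg]; split => [t tT|t]; last by apply: cvgB; [exact: cf|exact: cg].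
by have := is_deriveB (df t tT) (dg t tT).
Qed.

(** A real solution of u'' + L^s u + a u + b u' = 0 with velocity v, where m_n is
    the n-th eigenvalue of L^s: only what the energy estimate uses is kept,
    namely bounded norms on [0, T] and the equation for each coefficient. *)
Record real_solution (T : R) (m : nat -> R) (phi : nat -> measurableTypeR R -> R)
    (a b : measurableTypeR R -> R) (u v : R -> measurableTypeR R -> R) : Prop := {
  rs_L2 : forall t, 0 <= t <= T -> L2 (u t) /\ L2 (v t);
  rs_bounded : exists M, forall t, 0 <= t <= T ->
    ip mu (u t) (u t) <= M /\ ip mu (v t) (v t) <= M;
  rs_deriv1 : forall n,
    deriv_on T (fun t => ip mu (u t) (phi n)) (fun t => ip mu (v t) (phi n));
  rs_deriv2 : forall n, deriv_on T (fun t => ip mu (v t) (phi n))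
    (fun t => - (m n * ip mu (u t) (phi n))
              - ip mu (fun x => a x * u t x + b x * v t x) (phi n)) }.

Variables (m : nat -> R) (phi : nat -> measurableTypeR R -> R).
Hypothesis m_ge0 : forall n, 0 <= m n.
Hypothesis phiL2 : forall n, L2 (phi n).
Hypothesis phi_ortho : forall i j, ip mu (phi i) (phi j) = (i == j)%:R.
Hypothesis phi_complete : forall f, L2 f -> forall e, 0 < e ->
  exists N, forall n, (N <= n)%N ->
    ip mu f f <= \sum_(k < n) ip mu f (phi k) ^+ 2 + e.

(** Parseval: bounds on the partial sums of the coefficients of f and g bound
    their norms. *)
Lemma parseval2_le f g C : L2 f -> L2 g ->
  (forall n, \sum_(k < n) (ip mu f (phi k) ^+ 2 + ip mu g (phi k) ^+ 2) <= C) ->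
  ip mu f f + ip mu g g <= C.
Proof.
move=> lf lg hC; apply/ler_addgt0Pr => e e0.
have e2 : 0 < e / 2 by rewrite divr_gt0.
have [N hN] := phi_complete lf e2; have [N' hN'] := phi_complete lg e2.
have := hN (maxn N N') (leq_maxl _ _); have := hN' (maxn N N') (leq_maxr _ _).
have := hC (maxn N N'); rewrite big_split /=; lra.
Qed.

(** The difference of the lower order terms of the two equations is
    a' w + b' z + (a' - a) u + (b' - b) v, where w = u' - u and z = v' - v. *)
Lemma source_bound (A eta M : R) (a b a' b' u u' v v' : measurableTypeR R -> R) :
  0 <= A -> 0 <= eta ->
  measurable_fun setT a -> measurable_fun setT b ->
  measurable_fun setT a' -> measurable_fun setT b' ->
  (\forall x \ae mu, a' x ^+ 2 <= A) -> (\forall x \ae mu, b' x ^+ 2 <= A) ->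
  (\forall x \ae mu, (a' x - a x) ^+ 2 <= eta) ->
  (\forall x \ae mu, (b' x - b x) ^+ 2 <= eta) ->
  L2 u -> L2 u' -> L2 v -> L2 v' ->
  ip mu u u <= M -> ip mu v v <= M ->
  exists F : measurableTypeR R -> R, [/\ L2 F,
    F = (fun x => a' x * u' x + b' x * v' x - (a x * u x + b x * v x)) &
    ip mu F F <= 4 * A * (ip mu (fun x => u' x - u x) (fun x => u' x - u x) +
       ip mu (fun x => v' x - v x) (fun x => v' x - v x)) + 8 * eta * M].
Proof.
move=> A0 eta0 ma mb ma' mb' aA bA ae be lu lu' lv lv' uM vM.
have [lF1 F1] := L2_mul_bounded ma' aA (L2B lu' lu).
have [lF2 F2] := L2_mul_bounded mb' bA (L2B lv' lv).
have [lF3 F3] := L2_mul_bounded (measurable_funB ma' ma) ae lu.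
have [lF4 F4] := L2_mul_bounded (measurable_funB mb' mb) be lv.
have h12 := ip_sqrD_le lF1 lF2; have h34 := ip_sqrD_le lF3 lF4.
have h := ip_sqrD_le (L2D lF1 lF2) (L2D lF3 lF4).
have lF := L2D (L2D lF1 lF2) (L2D lF3 lF4).
have FE : (fun x => a' x * (u' x - u x) + b' x * (v' x - v x) +
   ((a' x - a x) * u x + (b' x - b x) * v x)) =
   (fun x => a' x * u' x + b' x * v' x - (a x * u x + b x * v x)).
  by apply/funext => x; ring.
exists (fun x => a' x * u' x + b' x * v' x - (a x * u x + b x * v x)).
split => //; first by rewrite -FE.
rewrite -FE; apply: (le_trans h).
have : eta * ip mu u u <= eta * M by rewrite ler_wpM2l.
have : eta * ip mu v v <= eta * M by rewrite ler_wpM2l.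
set x1 := ip mu _ _ in h12 *; lra.
Qed.

(** The primes mark the perturbed data and do not denote derivatives.  Let me be
    the sum of the squared norms of u' - u and v' - v, and let P be the supremum
    of me t exp(- kap t) on [0, T].  The energy bound for the first n modes,
    uniform in n, gives P <= E0 + delta + P / 2, hence P <= 2 (E0 + delta);
    this plays the part of the Gronwall lemma. *)
Lemma real_stability (T A eta M E0 : R) (a b a' b' : measurableTypeR R -> R)
    (u v u' v' : R -> measurableTypeR R -> R) :
  0 <= T -> 0 <= A -> 0 <= eta ->
  measurable_fun setT a -> measurable_fun setT b ->
  measurable_fun setT a' -> measurable_fun setT b' ->
  (\forall x \ae mu, a' x ^+ 2 <= A) -> (\forall x \ae mu, b' x ^+ 2 <= A) ->
  (\forall x \ae mu, (a' x - a x) ^+ 2 <= eta) ->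
  (\forall x \ae mu, (b' x - b x) ^+ 2 <= eta) ->
  real_solution T m phi a b u v -> real_solution T m phi a' b' u' v' ->
  (forall t, 0 <= t <= T -> ip mu (u t) (u t) <= M /\ ip mu (v t) (v t) <= M) ->
  (forall n, \sum_(k < n) ((ip mu (v' 0) (phi k) - ip mu (v 0) (phi k)) ^+ 2 +
     (m k + 1) * (ip mu (u' 0) (phi k) - ip mu (u 0) (phi k)) ^+ 2) <= E0) ->
  forall t, 0 <= t <= T ->
  ip mu (fun x => u' t x - u t x) (fun x => u' t x - u t x) <=
    2 * (E0 + 8 * eta * M) * expR ((3 + 2 * (4 * A)) * t).
Proof.
move=> T0 A0 eta0 ma mb ma' mb' aA bA ae be hu hu' hM hE0.
set kap := 3 + 2 * (4 * A); set delta := 8 * eta * M.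
have zT : 0 <= (0:R) <= T by rewrite lexx.
have M0 : 0 <= M by have [] := hM 0 zT; move=> h _; exact: le_trans (ip_ge0 _ _) h.
have delta0 : 0 <= delta by rewrite !mulr_ge0.
have E00 : 0 <= E0 by have := hE0 0%N; rewrite big_ord0.
pose w t x := u' t x - u t x; pose z t x := v' t x - v t x.
pose me t := ip mu (w t) (w t) + ip mu (z t) (z t).
have me0 t : 0 <= me t by rewrite addr_ge0// ip_ge0.
have lw t : 0 <= t <= T -> L2 (w t) /\ L2 (z t).
  move=> tT; have [l1 l2] := rs_L2 hu tT; have [l3 l4] := rs_L2 hu' tT.
  by split; exact: L2B.
have [M1 hM1] : exists M1, forall t, 0 <= t <= T -> me t * expR (- (kap * t)) <= M1.
  have [M' hM'] := rs_bounded hu'.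
  exists (2 * (M' + M) + 2 * (M' + M)) => t tT.
  have [l1 l2] := rs_L2 hu tT; have [l3 l4] := rs_L2 hu' tT.
  have [m1 m2] := hM t tT; have [m3 m4] := hM' t tT.
  have ub (f g : measurableTypeR R -> R) : L2 f -> L2 g -> ip mu f f <= M' ->
     ip mu g g <= M -> ip mu (fun x => f x - g x) (fun x => f x - g x) <= 2 * (M' + M).
    move=> lf lg fM gM; have ln := L2N lg; apply: (le_trans (ip_sqrD_le lf ln)).
    by rewrite ipNl// ipNr// opprK mulrDr lerD// ler_pM2l.
  have h1 := ub _ _ l3 l1 m3 m1; have h2 := ub _ _ l4 l2 m4 m2.
  apply: (@le_trans _ _ (me t)); last exact: lerD.
  rewrite ler_piMr// -expR0 ler_expR oppr_le0 mulr_ge0//; last by case/andP: tT.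
  by rewrite addr_ge0// !mulr_ge0.
pose S := [set y | exists2 t, 0 <= t <= T & y = me t * expR (- (kap * t))].
pose P := sup S.
have ubS : has_ubound S by exists M1 => y [t tT ->]; exact: hM1.
have SP t : 0 <= t <= T -> me t * expR (- (kap * t)) <= P.
  move=> tT; apply: sup_upper_bound; last by exists t.
  by split=> //; exists (me t * expR (- (kap * t))); exists t.
have P0 : 0 <= P by apply: le_trans (SP 0 zT); rewrite mulr_ge0// expR_ge0.
have meP t : 0 <= t <= T -> me t <= P * expR (kap * t).
  by move=> tT; have := SP t tT; rewrite expRN ler_pdivrMr// expR_gt0.
have step t : 0 <= t <= T -> me t <= (E0 + delta + P / 2) * expR (kap * t).
  move=> tT; have [lwt lzt] := lw t tT; apply: parseval2_le => // n.
  pose W k t := ip mu (u' t) (phi k) - ip mu (u t) (phi k).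
  pose V k t := ip mu (v' t) (phi k) - ip mu (v t) (phi k).
  pose F k t := ip mu (fun x => a' x * u' t x + b' x * v' t x) (phi k) -
     ip mu (fun x => a x * u t x + b x * v t x) (phi k).
  have [l1 l2] := rs_L2 hu tT; have [l3 l4] := rs_L2 hu' tT.
  have : \sum_(k <- index_iota 0 n) (V k t ^+ 2 + (m k + 1) * W k t ^+ 2) <=
      (E0 + delta + P / 2) * expR (kap * t).
    apply: (@energy_bound R T (4 * A) delta P E0 _ m W V F) => //; rewrite ?mulr_ge0//.
    - move=> k; apply: diff_onB; apply: deriv_on_diff; first exact: (rs_deriv1 hu').
      exact: (rs_deriv1 hu).
    - move=> k; have := diff_onB (deriv_on_diff (rs_deriv2 hu' k)) (deriv_on_diff (rs_deriv2 hu k)).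
      by congr diff_on; apply/funext => y; rewrite /W /F; ring.
    - move=> y yT; rewrite -/kap.
      have {l1 l2 l3 l4} [l1 l2] := rs_L2 hu yT; have [l3 l4] := rs_L2 hu' yT.
      have [m1 m2] := hM y yT.
      have [G [lG GE hG]] := source_bound A0 eta0 ma mb ma' mb' aA bA ae be l1 l3 l2 l4 m1 m2.
      have FE k : F k y = ip mu G (phi k).
        have mul (c f : measurableTypeR R -> R) C : measurable_fun setT c -> 
          (\forall x \ae mu, c x ^+ 2 <= C) -> L2 f -> L2 (fun x => c x * f x).
          by move=> mc cC lf; have [] := L2_mul_bounded mc cC lf.
        have bd (c c' : measurableTypeR R -> R) : (\forall x \ae mu, c' x ^+ 2 <= A) ->
            (\forall x \ae mu, (c' x - c x) ^+ 2 <= eta) ->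
            \forall x \ae mu, c x ^+ 2 <= 2 * A + 2 * eta.
          apply: ae_imp2 => x h1 h2; have := sqr_ge0 (2 * c' x - c x); move: h1 h2.
          by rewrite !expr2; nra.
        rewrite /F GE ipBl//; apply: L2D.
        - exact: mul aA l3.
        - exact: mul bA l4.
        - exact: mul (bd _ _ aA ae) l1.
        - exact: mul (bd _ _ bA be) l2.
      under eq_bigr do rewrite FE.
      rewrite big_mkord; apply: (le_trans (bessel phiL2 phi_ortho n lG)).
      by apply: (le_trans hG); rewrite lerD2r ler_wpM2l ?mulr_ge0//; exact: meP.
    - by rewrite big_mkord; exact: hE0.
  rewrite big_mkord; apply: le_trans; apply: ler_sum => k _.
  rewrite !ipBl// addrC lerD2l mulrDl mul1r lerDr.
  by rewrite mulr_ge0// sqr_ge0.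
have PE : P <= E0 + delta + P / 2.
  apply: sup_le_ub; first by exists (me 0 * expR (- (kap * 0))); exists 0.
  move=> y [t tT ->].
  by rewrite expRN ler_pdivrMr ?expR_gt0//; exact: step.
move=> t tT; apply: (@le_trans _ _ (me t)); first by rewrite lerDl ip_ge0.
by apply: (le_trans (meP t tT)); rewrite ler_wpM2r ?expR_ge0//; lra.
Qed.

End RealStability.

(** * Complex square-integrable functions *)

Section ComplexL2.
Context {R : realType}.
Notation mu := (leb01 R).
Notation L2 f := (f \in Lfun mu 2%:E).
Notation normc := ComplexField.Normc.normc.
Implicit Types (f g h : R -> R[i]) (c : R[i]).

(** The real and imaginary parts, as functions on the measurable space that
    carries the Lebesgue measure. *)
Definition re f (x : measurableTypeR R) : R := complex.Re (f x).
Definition im f (x : measurableTypeR R) : R := complex.Im (f x).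

(** The squared L^2 norm of a complex function. *)
Definition nsq f : R := ip mu (re f) (re f) + ip mu (im f) (im f).

Lemma nsq_ge0 f : 0 <= nsq f.
Proof. by rewrite addr_ge0// ip_ge0. Qed.

Lemma ReDc c c' : complex.Re (c + c') = complex.Re c + complex.Re c'.
Proof. by case: c c' => ? ? []. Qed.
Lemma ImDc c c' : complex.Im (c + c') = complex.Im c + complex.Im c'.
Proof. by case: c c' => ? ? []. Qed.
Lemma ReNc c : complex.Re (- c) = - complex.Re c.
Proof. by case: c. Qed.
Lemma ImNc c : complex.Im (- c) = - complex.Im c.
Proof. by case: c. Qed.
Lemma ReMr (a : R) c : complex.Re (a%:C%C * c) = a * complex.Re c.
Proof. by case: c => b e /=; rewrite mul0r subr0. Qed.
Lemma ImMr (a : R) c : complex.Im (a%:C%C * c) = a * complex.Im c.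
Proof. by case: c => b e /=; rewrite mul0r addr0. Qed.
Lemma complexP c c' : complex.Re c = complex.Re c' -> complex.Im c = complex.Im c' -> c = c'.
Proof. by case: c c' => ? ? [? ?] /= -> ->. Qed.

Lemma Re_le_normc c : `|complex.Re c| <= normc c.
Proof.
by case: c => a b /=; rewrite -sqrtr_sqr ler_wsqrtr// lerDl sqr_ge0.
Qed.
Lemma Im_le_normc c : `|complex.Im c| <= normc c.
Proof.
by case: c => a b /=; rewrite -sqrtr_sqr ler_wsqrtr// lerDr sqr_ge0.
Qed.

Lemma reB f g : re (fun x => f x - g x) = (fun x => re f x - re g x).
Proof. by apply/funext => x; rewrite /re ReDc ReNc. Qed.
Lemma imB f g : im (fun x => f x - g x) = (fun x => im f x - im g x).
Proof. by apply/funext => x; rewrite /im ImDc ImNc. Qed.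

Lemma L2C_B f g : L2C f -> L2C g -> L2C (fun x => f x - g x).
Proof.
move=> [f1 f2] [g1 g2].
suff : L2 (re (fun x => f x - g x)) /\ L2 (im (fun x => f x - g x)) by [].
by rewrite reB imB; split; exact: L2B.
Qed.

Lemma reZ (a : R) f : re (fun x => a%:C%C * f x) = (fun x => a * re f x).
Proof. by apply/funext => x; rewrite /re ReMr. Qed.
Lemma imZ (a : R) f : im (fun x => a%:C%C * f x) = (fun x => a * im f x).
Proof. by apply/funext => x; rewrite /im ImMr. Qed.

Lemma L2C_rscale (a : R) f : L2C f -> L2C (fun x => a%:C%C * f x).
Proof.
move=> [f1 f2].
suff : L2 (re (fun x => a%:C%C * f x)) /\ L2 (im (fun x => a%:C%C * f x)) by [].
by rewrite reZ imZ; split; exact: L2Z.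
Qed.

Lemma normL2E f : L2C f -> normL2 f = (Num.sqrt (nsq f))%:E.
Proof.
move=> [l1 l2]; rewrite /normL2 unlock.
have -> : (\int[mu]_x (`|(EFin \o (fun x => normc (f x))) x| `^ 2))%E = (nsq f)%:E.
  rewrite /nsq /ip EFinD /Rintegral !fineK; try
    by apply: integrable_fin_num => //; exact: ip_integrable.
  rewrite -integralD//; try exact: ip_integrable.
  apply: eq_integral => x _; rewrite /= /re /im; case: (f x) => a b /=.
  by rewrite powR_mulrn// ger0_norm ?sqrtr_ge0// sqr_sqrtr ?addr_ge0 ?sqr_ge0// !expr2 EFinD.
by rewrite poweR_EFin powR12_sqrt// nsq_ge0.
Qed.

Lemma coefE (phi : nat -> R -> R) n f :
  coef phi n f = (ip mu (re f) (phi n) +i* ip mu (im f) (phi n))%C.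
Proof.
rewrite /coef /intC; congr (_ +i* _)%C; apply: eq_Rintegral => x _;
  by rewrite mulrC ?ReMr ?ImMr mulrC.
Qed.

Lemma intC_mul f g : L2C f -> L2C g -> intC setT (fun x => f x * g x) =
  ((ip mu (re f) (re g) - ip mu (im f) (im g)) +i*
   (ip mu (re f) (im g) + ip mu (im f) (re g)))%C.
Proof.
move=> [f1 f2] [g1 g2]; rewrite /intC /ip.
rewrite -RintegralB//; try exact: ip_integrable.
rewrite -RintegralD//; try exact: ip_integrable.
congr (_ +i* _)%C; apply: eq_Rintegral => x _; rewrite /re /im;
  by case: (f x) (g x) => ? ? [].
Qed.

Lemma intC_mulBl f f' g : L2C f -> L2C f' -> L2C g ->
  intC setT (fun x => (f x - f' x) * g x) =
  intC setT (fun x => f x * g x) - intC setT (fun x => f' x * g x).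
Proof.
move=> lf lf' lg; have lB := L2C_B lf lf'; rewrite !intC_mul//.
case: lf lf' lg => [? ?] [? ?] [? ?].
rewrite reB imB !ipBl//.
by apply: complexP => /=; rewrite ?ReDc ?ReNc ?ImDc ?ImNc /=; ring.
Qed.

Lemma SL_graph_scale (q : R -> R) (a : R) f g :
  SL_graph q f g -> SL_graph q (fun x => a%:C%C * f x) (fun x => a%:C%C * g x).
Proof.
move=> [lf [lg [y0 [y1 [y2 [fy ac1 ac2 [y00 y01] gy]]]]]].
split; [exact: L2C_rscale|split; first exact: L2C_rscale].
exists (fun x => a%:C%C * y0 x), (fun x => a%:C%C * y1 x), (fun x => a%:C%C * y2 x).
have acZ (z z' : R -> R[i]) : ac_deriv z z' ->
    ac_deriv (fun x => a%:C%C * z x) (fun x => a%:C%C * z' x).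
  move=> [lz zE]; split; first exact: L2C_rscale.
  move=> x x01; rewrite zE// mulrDr; congr (_ + _).
  have mI : measurable (`[0%R, x] : set (measurableTypeR R)) by exact: measurable_itv.
  have [lI _] := L2_indic01 mI; have [l1 l2] := lz.
  apply: complexP; rewrite ?ReMr ?ImMr /= !Rintegral_indic -ipZl//;
    by congr (ip mu _ _); apply/funext => y; rewrite ?ReMr ?ImMr.
split; [|exact: acZ|exact: acZ| |].
- by move: fy; apply: ae_imp => x ->.
- by rewrite y00 y01 mulr0.
- by move: gy; apply: ae_imp => x ->; ring.
Qed.

End ComplexL2.

(** * Eigenfunction expansions and Sobolev norms *)

Section Spectral.
Context {R : realType}.
Notation mu := (leb01 R).
Notation L2 f := (f \in Lfun mu 2%:E).
Implicit Types (f g h : R -> R[i]).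

(** A family that tends to 0 is eventually below any positive number. *)
Lemma cvge0_near (X : Type) (F : set_system X) {FF : Filter F} (f : X -> \bar R) :
  f @ F --> 0%E -> forall e : R, 0 < e -> \forall x \near F, (f x < e%:E)%E.
Proof.
move=> h e e0; have := @open_ereal_lt' R 0%E e%:E; rewrite lte_fin => /(_ e0).
exact: h.
Qed.

Variables (q : R -> R) (lam : nat -> R) (phi : nat -> R -> R).
Hypothesis hphi : SL_eigenbasis q lam phi.

Let phiL2 : forall n, L2 (phi n : measurableTypeR R -> R) := eigenfun_L2 hphi.
Let ortho := eigenfun_ortho hphi.

Lemma re_partial_sum (c : nat -> R[i]) N :
  re (partial_sum phi c N) = (fun x => \sum_(k < N) complex.Re (c k) * phi k x).
Proof.
apply/funext => x; rewrite /re /partial_sum.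
rewrite (big_morph _ ReDc (erefl : complex.Re 0 = 0)).
by apply: eq_bigr => k _; rewrite mulrC ReMr mulrC.
Qed.

Lemma im_partial_sum (c : nat -> R[i]) N :
  im (partial_sum phi c N) = (fun x => \sum_(k < N) complex.Im (c k) * phi k x).
Proof.
apply/funext => x; rewrite /im /partial_sum.
rewrite (big_morph _ ImDc (erefl : complex.Im 0 = 0)).
by apply: eq_bigr => k _; rewrite mulrC ImMr mulrC.
Qed.

Lemma L2_lincomb (c : nat -> R) N :
  L2 (fun x : measurableTypeR R => \sum_(k < N) c k * phi k x).
Proof. by apply: L2_sum => k; exact: L2Z. Qed.

Lemma L2C_partial_sum c N : L2C (partial_sum phi c N).
Proof.
suff : L2 (re (partial_sum phi c N)) /\ L2 (im (partial_sum phi c N)) by [].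
rewrite re_partial_sum im_partial_sum; split.
  exact: (L2_lincomb (fun k => complex.Re (c k))).
exact: (L2_lincomb (fun k => complex.Im (c k))).
Qed.

Lemma expansion_near c g : L2C g -> expansion phi c g -> forall e : R, 0 < e ->
  exists N0, forall N, (N0 <= N)%N ->
    nsq (fun x => partial_sum phi c N x - g x) <= e.
Proof.
move=> lg cg e e0; have se : 0 < Num.sqrt e by rewrite sqrtr_gt0.
have [N0 _ hN] := cvge0_near cg se.
exists N0 => N N0N; have := hN N N0N.
rewrite /= normL2E; last by apply: L2C_B => //; exact: L2C_partial_sum.
by rewrite lte_fin ltr_sqrt// => /ltW.
Qed.

(** Completeness of the eigenfunctions, in the form of Parseval's inequality. *)
Lemma eigenfun_complete (f : measurableTypeR R -> R) : L2 f -> forall e, 0 < e ->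
  exists N, forall n, (N <= n)%N ->
    ip mu f f <= \sum_(k < n) ip mu f (phi k) ^+ 2 + e.
Proof.
move=> lf e e0; pose g x : R[i] := (f x)%:C%C.
have lg : L2C g by split => //; exact: (L2_0 mu).
have [N hN] := expansion_near lg (eigen_basis hphi lg) e0.
exists N => n /hN; rewrite /nsq reB => h.
rewrite -lerBlDl; apply: le_trans h.
rewrite re_partial_sum.
have cE k : complex.Re (coef phi k g) = ip mu f (phi k) by rewrite coefE.
under [X in ip mu X X + _]eq_fun do under eq_bigr do rewrite cE.
have := ip_sub_projection phiL2 ortho n lf.
rewrite -/(re g); move=> /= ->; by rewrite lerDl ip_ge0.
Qed.

(** Functions with the same coefficients have the same inner products. *)
Lemma eq_ip_coef (f f' p : measurableTypeR R -> R) : L2 f -> L2 f' -> L2 p ->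
  (forall k, ip mu f (phi k) = ip mu f' (phi k)) -> ip mu p f = ip mu p f'.
Proof.
move=> lf lf' lp ff; have ld := L2B lf lf'.
have d0 : ip mu (fun x => f x - f' x) (fun x => f x - f' x) = 0.
  apply/eqP; rewrite eq_le ip_ge0 andbT; apply/ler_addgt0Pr => e e0.
  have [N /(_ N (leqnn N))] := eigenfun_complete ld e0.
  rewrite big1// => k _; rewrite ipBl//.
  by rewrite ff subrr expr0n.
have := cauchy_schwarz lp ld; rewrite d0 mulr0 => h.
have /eqP : ip mu p (fun x => f x - f' x) ^+ 2 = 0.
  by apply/eqP; rewrite eq_le h sqr_ge0.
by rewrite sqrf_eq0 ipC ipBl// subr_eq0 !(ipC _ _ p) => /eqP.
Qed.

Lemma sqr_coef_le_nsq n f : L2C f ->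
  ip mu (re f) (phi n) ^+ 2 <= nsq f /\ ip mu (im f) (phi n) ^+ 2 <= nsq f.
Proof.
move=> [l1 l2]; split.
  apply: (le_trans (cauchy_schwarz l1 (phiL2 n))).
  by rewrite ortho eqxx mulr1 lerDl ip_ge0.
apply: (le_trans (cauchy_schwarz l2 (phiL2 n))).
by rewrite ortho eqxx mulr1 lerDr ip_ge0.
Qed.

(** The coefficients of an L^2-convergent expansion are those of its sum. *)
Lemma expansion_coef c g n : L2C g -> expansion phi c g -> coef phi n g = c n.
Proof.
move=> lg cg.
have key (x y : R) : (forall e, 0 < e -> (x - y) ^+ 2 <= e) -> y = x.
  move=> h; apply/eqP; rewrite eq_sym -subr_eq0 -sqrf_eq0 eq_le sqr_ge0 andbT.
  by apply/ler_addgt0Pr => e /h; rewrite add0r.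
rewrite coefE; apply: complexP => /=; apply: key => e e0.
  have [N hN] := expansion_near lg cg e0.
  have lP := L2C_partial_sum c (maxn N n.+1).
  have := hN (maxn N n.+1) (leq_maxl _ _); apply: le_trans.
  apply: (le_trans _ (sqr_coef_le_nsq n (L2C_B lP lg)).1).
  rewrite reB re_partial_sum ipBl//; [|exact: (L2_lincomb (fun k => complex.Re (c k)))|exact: lg.1].
  have -> : ip mu (fun x => \sum_(k < maxn N n.+1) complex.Re (c k) * phi k x) (phi n)
     = complex.Re (c n).
    have := @ip_lincomb_basis _ _ _ _ _ phiL2 ortho (index_iota 0 (maxn N n.+1))
      (fun k => complex.Re (c k)) n (iota_uniq _ _).
    rewrite mem_index_iota /= leq_maxr => <-; congr (ip mu _ _).
    by apply/funext => x; rewrite big_mkord.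
  by [].
have [N hN] := expansion_near lg cg e0.
have lP := L2C_partial_sum c (maxn N n.+1).
have := hN (maxn N n.+1) (leq_maxl _ _); apply: le_trans.
apply: (le_trans _ (sqr_coef_le_nsq n (L2C_B lP lg)).2).
rewrite imB im_partial_sum ipBl//; [|exact: (L2_lincomb (fun k => complex.Im (c k)))|exact: lg.2].
have -> : ip mu (fun x => \sum_(k < maxn N n.+1) complex.Im (c k) * phi k x) (phi n)
   = complex.Im (c n).
  have := @ip_lincomb_basis _ _ _ _ _ phiL2 ortho (index_iota 0 (maxn N n.+1))
    (fun k => complex.Im (c k)) n (iota_uniq _ _).
  rewrite mem_index_iota /= leq_maxr => <-; congr (ip mu _ _).
  by apply/funext => x; rewrite big_mkord.
by [].
Qed.

(** The n-th eigenfunction as a complex-valued function. *)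
Definition phiC n : R -> R[i] := fun x => (phi n x)%:C%C.

Lemma L2C_phiC n : L2C (phiC n).
Proof. by split; [exact: phiL2|exact: (L2_0 mu)]. Qed.

Lemma coef_phiC k n : coef phi k (phiC n) = ((n == k)%:R)%:C%C.
Proof.
rewrite coefE; apply: complexP => /=; first exact: ortho.
by rewrite -[RHS](ip0l mu (phi k)).
Qed.

(** The eigenfunctions are test functions. *)
Lemma test_phiC n : test_fun q (phiC n).
Proof.
move=> m; suff h (a : R) : exists f, SLpow_graph q m (fun x => a%:C%C * phiC n x) f.
  have [f hf] := h 1; exists f; move: hf; congr SLpow_graph.
  by apply/funext => x; rewrite mul1r.
elim: m a => [|m IH] a /=.
  have l := L2C_rscale a (L2C_phiC n).
  by exists (fun x => a%:C%C * phiC n x); split => //; split => //; exact: nearW.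
have [f hf] := IH (a * lam n); exists f.
exists (fun x => (a * lam n)%:C%C * phiC n x) => //.
have := SL_graph_scale a (eigen_fun hphi n); congr SL_graph.
by apply/funext => x; rewrite /phiC !rmorphM mulrA.
Qed.

Lemma L2C_frac_pow (s : R) f : L2C (frac_pow lam phi s f).
Proof.
rewrite /frac_pow; case: xgetP => [g _ [lg _] //|_].
by split; exact: (L2_0 mu).
Qed.

(** The fractional power L^s multiplies phi n by (lam n)^s, tested against an
    arbitrary h in L^2. *)
Lemma frac_pow_phiC (s : R) n h : L2C h ->
  intC setT (fun x => h x * frac_pow lam phi s (phiC n) x) =
  (lam n `^ s)%:C%C * coef phi n h.
Proof.
move=> lh; set G := frac_pow _ _ _ _; set a := lam n `^ s.
have [lG eG] : L2C G /\ expansion phi (fun k => (lam k `^ s)%:C%C * coef phi k (phiC n)) G.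
  apply: (@xgetPex _ (fun=> 0) [set g | L2C g /\ expansion phi
    (fun k => (lam k `^ s)%:C%C * coef phi k (phiC n)) g]).
  exists (fun x => a%:C%C * phiC n x); split; first exact: L2C_rscale (L2C_phiC n).
  apply: cvg_near_cst; exists n.+1 => // N /= nN.
  have z0 : L2C (fun _ : R => 0 : R[i]) by split; exact: (L2_0 mu).
  have -> : (fun x => partial_sum phi (fun k => (lam k `^ s)%:C%C * coef phi k (phiC n)) N x
      - a%:C%C * phiC n x) = (fun _ : R => 0 : R[i]).
    apply/funext => x; rewrite /partial_sum (bigD1 (Ordinal nN))//= big1 => [|k kn].
      by rewrite coef_phiC eqxx mulr1 addr0 subrr.
    rewrite coef_phiC; case: eqVneq => [nk|]; last by rewrite mulr0 mul0r.
    by move: kn; rewrite -val_eqE /= -nk eqxx.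
  rewrite normL2E// (_ : nsq _ = 0) ?sqrtr0//.
  by rewrite /nsq -[RHS]addr0; congr (_ + _); exact: ip0l.
have cG k : coef phi k G = (lam k `^ s)%:C%C * coef phi k (phiC n).
  exact: expansion_coef lG eG.
have rG k : ip mu (re G) (phi k) = ip mu (fun x => a * phi n x) (phi k).
  rewrite ipZl// ortho; have := congr1 (@complex.Re R) (cG k).
  rewrite coefE ReMr coef_phiC /= => ->.
  by rewrite /a; case: (n =P k) => [->//|_]; rewrite !mulr0.
have iG k : ip mu (im G) (phi k) = ip mu (fun=> 0) (phi k).
  rewrite ip0l; have := congr1 (@complex.Im R) (cG k).
  by rewrite coefE ImMr coef_phiC /= mulr0.
case: (lh) (lG) => [h1 h2] [G1 G2]; rewrite intC_mul//.
have laphi := L2Z a (phiL2 n).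
have e1 p : L2 p -> ip mu p (re G) = a * ip mu p (phi n).
  by move=> lp; rewrite (eq_ip_coef G1 laphi lp rG) ipZr.
have e2 p : L2 p -> ip mu p (im G) = 0.
  by move=> lp; rewrite (eq_ip_coef G2 (L2_0 mu) lp iG) ipC ip0l.
rewrite !e1// !e2// coefE subr0 add0r.
by apply: complexP; rewrite ?ReMr ?ImMr.
Qed.

(** The Sobolev norm of a difference is the L^2 norm of a function whose n-th
    coefficient is (lam n)^(s/2) times that of the difference. *)
Lemma W_difference (s : R) f1 f2 :
  W_SL q lam phi s f1 -> W_SL q lam phi s f2 ->
  exists g, [/\ L2C g,
    forall n, coef phi n g = (lam n `^ (s / 2))%:C%C * coef phi n (fun x => f1 x - f2 x) &
    normW_SL q lam phi s (fun x => f1 x - f2 x) = normL2 g].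
Proof.
move=> [l1 [_ [g1 [lg1 d1]]]] [l2 [_ [g2 [lg2 d2]]]].
set h := fun x => f1 x - f2 x; have lh : L2C h by exact: L2C_B.
pose w := frac_pow_dist lam phi (s / 2) (dist_of h).
(* the difference of the two densities is a density of the difference *)
have [lg dg] : is_density q w (density q w).
  apply: (@xgetPex _ (fun=> 0) [set g | is_density q w g]).
  exists (fun x => g1 x - g2 x); split; first exact: L2C_B.
  move=> f tf.
  have lf : L2C f by have [? []] := tf 0%N.
  rewrite /w /frac_pow_dist /dist_of /h.
  rewrite (intC_mulBl lg1 lg2 lf) intC_mulBl//; last exact: L2C_frac_pow.
  by have := d1 f tf; have := d2 f tf; rewrite /frac_pow_dist /dist_of => -> ->.
exists (density q w); split => // n.
have := dg _ (test_phiC n); rewrite /w /frac_pow_dist {1}/dist_of frac_pow_phiC// => ->.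
Qed.

End Spectral.

(** * Real and imaginary parts of a solution *)

Section Parts.
Context {R : realType}.
Notation mu := (leb01 R).
Notation L2 f := (f \in Lfun mu 2%:E).
Notation normc := ComplexField.Normc.normc.

(** The L^2 norm of a real function. *)
Definition n2 (f : measurableTypeR R -> R) := Num.sqrt (ip mu f f).

Lemma n2_ge0 f : 0 <= n2 f. Proof. exact: sqrtr_ge0. Qed.

Lemma n2_triangle f g : L2 f -> L2 g -> n2 (fun x => f x + g x) <= n2 f + n2 g.
Proof.
move=> lf lg; have fg0 : 0 <= n2 f + n2 g by rewrite addr_ge0// n2_ge0.
rewrite -[leRHS]ger0_norm// -sqrtr_sqr ler_wsqrtr// ip_sqrD// sqrrD.
rewrite !sqr_sqrtr ?ip_ge0// lerD2r lerD2l mulr_natl lerMn2r/=.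
apply: (le_trans (ler_norm _)); rewrite -sqrtr_sqr -sqrtrM ?ip_ge0//.
by rewrite ler_wsqrtr// cauchy_schwarz.
Qed.

Lemma n2Z (c : R) f : L2 f -> n2 (fun x => c * f x) = `|c| * n2 f.
Proof.
move=> lf; have lcf := L2Z c lf.
by rewrite /n2 ipZl// ipZr// mulrA -expr2 sqrtrM ?sqr_ge0// sqrtr_sqr.
Qed.

Lemma n2_dist f g : L2 f -> L2 g -> `|n2 f - n2 g| <= n2 (fun x => f x - g x).
Proof.
move=> lf lg; have ld := L2B lf lg.
have h : n2 f <= n2 (fun x => f x - g x) + n2 g.
  have := n2_triangle ld lg; congr (_ <= _); congr n2.
  by apply/funext => x; rewrite subrK.
have h' : n2 g <= n2 (fun x => f x - g x) + n2 f.
  have := n2_triangle (L2Z (-1) ld) lf; rewrite n2Z// normrN normr1 mul1r.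
  congr (_ <= _); congr n2; apply/funext => x; ring.
by rewrite ler_norml; apply/andP; split; lra.
Qed.

Lemma within_dnbhs_lt (T t : R) (f : R -> \bar R) :
  f r @[r --> within `[0, T] (dnbhs t)] --> 0%E -> forall e, 0 < e ->
  exists2 d, 0 < d & forall r, 0 <= r <= T -> r != t -> `|r - t| < d -> (f r < e%:E)%E.
Proof.
move=> h e e0.
have : \forall r \near within `[0, T] (dnbhs t), (f r < e%:E)%E by exact: cvge0_near h _ e0.
rewrite near_withinE near_withinE => /nbhs_ballP[d d0 hd].
exists d => // r rT rt rtd.
by have := hd r; rewrite /ball /= distrC => /(_ rtd rt); rewrite in_itv /= => /(_ rT).
Qed.

Lemma within_nbhs_lt (T t : R) (f : R -> \bar R) :
  f r @[r --> within `[0, T] (nbhs t)] --> 0%E -> forall e, 0 < e ->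
  exists2 d, 0 < d & forall r, 0 <= r <= T -> `|r - t| < d -> (f r < e%:E)%E.
Proof.
move=> h e e0.
have : \forall r \near within `[0, T] (nbhs t), (f r < e%:E)%E by exact: cvge0_near h _ e0.
rewrite near_withinE => /nbhs_ballP[d d0 hd].
exists d => // r rT rtd.
by have := hd r; rewrite /ball /= distrC => /(_ rtd); rewrite in_itv /= => /(_ rT).
Qed.

(** The real part for true and the imaginary part for false.  The operator and the
    coefficients are real, so both parts of a solution are real solutions. *)
Definition part (b : bool) (c : R[i]) : R := if b then complex.Re c else complex.Im c.

(** The pointwise real or imaginary part of a function. *)
Definition prt (b : bool) (f : R -> R[i]) (x : measurableTypeR R) : R := part b (f x).

Lemma partD b c c' : part b (c + c') = part b c + part b c'.
Proof. by case: b; rewrite /= ?ReDc ?ImDc. Qed.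
Lemma partN b c : part b (- c) = - part b c.
Proof. by case: b; rewrite /= ?ReNc ?ImNc. Qed.
Lemma partB b c c' : part b (c - c') = part b c - part b c'.
Proof. by rewrite partD partN. Qed.
Lemma partZ b (a : R) c : part b (a%:C%C * c) = a * part b c.
Proof. by case: b; rewrite /= ?ReMr ?ImMr. Qed.
Lemma part_le_normc b c : `|part b c| <= normc c.
Proof. by case: b; [exact: Re_le_normc|exact: Im_le_normc]. Qed.
Lemma L2_prt b f : L2C f -> L2 (prt b f).
Proof. by case: b => -[]. Qed.
Lemma prtB b f g : prt b (fun x => f x - g x) = (fun x => prt b f x - prt b g x).
Proof. by apply/funext => x; rewrite /prt partB. Qed.
Lemma ip_prt_le b f : ip mu (prt b f) (prt b f) <= nsq f.
Proof. by case: b; rewrite /nsq ?lerDl ?lerDr ip_ge0. Qed.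
Lemma nsq_prt f : nsq f = ip mu (prt true f) (prt true f) + ip mu (prt false f) (prt false f).
Proof. by []. Qed.
Lemma part_coef b (phi : nat -> R -> R) n f :
  part b (coef phi n f) = ip mu (prt b f) (phi n).
Proof. by rewrite coefE; case: b. Qed.

Lemma ae_eqC_prt b f g : ae_eqC f g -> \forall x \ae mu, prt b f x = prt b g x.
Proof. by apply: ae_imp => x; rewrite /prt => ->. Qed.

Lemma deriv_scal_part b T (c d : R -> R[i]) : deriv_scal T c d ->
  deriv_on T (fun t => part b (c t)) (fun t => part b (d t)).
Proof.
move=> cd t tT e e0; have /cvgrPdist_le /(_ e e0) := cd t tT.
rewrite near_withinE near_withinE => /nbhs_ballP[d' d'0 hd].
exists d' => // r rT rt rtd.
have := hd r; rewrite /ball /= distrC => /(_ rtd rt); rewrite in_itv /= => /(_ rT).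
rewrite sub0r normrN => h.
rewrite -partB -partZ -partB; apply: le_trans h.
exact: (le_trans (part_le_normc _ _) (ler_norm _)).
Qed.

Lemma deriv_path_nsq T (u v : R -> R -> R[i]) :
  (forall t, 0 <= t <= T -> L2C (u t)) -> (forall t, 0 <= t <= T -> L2C (v t)) ->
  deriv_path T u v -> forall t, 0 <= t <= T -> forall e, 0 < e ->
  exists2 d, 0 < d & forall r, 0 <= r <= T -> r != t -> `|r - t| < d ->
    nsq (fun x => ((r - t)^-1)%:C%C * (u r x - u t x) - v t x) <= e ^+ 2.
Proof.
move=> lu lv uv t tT e e0; have [d d0 hd] := within_dnbhs_lt (uv t tT) e0.
exists d => // r rT rt rtd; have := hd r rT rt rtd.
rewrite normL2E; last first.
  by apply: L2C_B (lv _ _) => //; apply: L2C_rscale; apply: L2C_B; exact: lu.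
rewrite lte_fin => /ltW h; rewrite -[leLHS]sqr_sqrtr ?nsq_ge0//.
by rewrite ler_sqr ?nnegrE ?sqrtr_ge0// ltW.
Qed.

Lemma cont_path_bounded T (v : R -> R -> R[i]) b : 0 <= T ->
  (forall t, 0 <= t <= T -> L2C (v t)) -> cont_path T (@normL2 R) v ->
  exists M, forall t, 0 <= t <= T -> ip mu (prt b (v t)) (prt b (v t)) <= M.
Proof.
move=> T0 lv cv.
have [|M hM] := @cont_on_bounded R T (fun t => n2 (prt b (v t))) T0.
  move=> t tT e e0; have [d d0 hd] := within_nbhs_lt (cv t tT) e0.
  exists d => // r rT rtd; have := hd r rT rtd.
  have lB := L2C_B (lv _ rT) (lv _ tT).
  rewrite normL2E// lte_fin => /ltW; apply: le_trans.
  have [l1 l2] := (L2_prt b (lv _ rT), L2_prt b (lv _ tT)).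
  by apply: (le_trans (n2_dist l1 l2)); rewrite -prtB ler_wsqrtr// ip_prt_le.
exists (M ^+ 2) => t /hM h.
rewrite -[leLHS]sqr_sqrtr ?ip_ge0// ler_sqr ?nnegrE ?sqrtr_ge0//.
exact: le_trans (n2_ge0 _) h.
Qed.

(** A differentiable path is continuous, hence bounded on [0, T]. *)
Lemma deriv_path_bounded T (u v : R -> R -> R[i]) b : 0 <= T ->
  (forall t, 0 <= t <= T -> L2C (u t)) -> (forall t, 0 <= t <= T -> L2C (v t)) ->
  deriv_path T u v ->
  exists M, forall t, 0 <= t <= T -> ip mu (prt b (u t)) (prt b (u t)) <= M.
Proof.
move=> T0 lu lv uv.
have [|M hM] := @cont_on_bounded R T (fun t => n2 (prt b (u t))) T0.
  move=> t tT e e0; have [d d0 hd] := deriv_path_nsq lu lv uv tT ltr01.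
  have g1 : 0 < 1 + n2 (prt b (v t)) by rewrite ltr_wpDr// n2_ge0.
  exists (Num.min d (e / (1 + n2 (prt b (v t))))); first by rewrite lt_min d0 divr_gt0.
  move=> r rT; rewrite lt_min => /andP[rd re].
  have [->|rt] := eqVneq r t; first by rewrite subrr normr0 ltW.
  have rt0 : r - t != 0 by rewrite subr_eq0.
  have [l1 l2] := (L2_prt b (lu _ rT), L2_prt b (lu _ tT)).
  have l3 := L2_prt b (lv _ tT).
  apply: (le_trans (n2_dist l1 l2)).
  pose D x := (r - t)^-1 * (prt b (u r) x - prt b (u t) x) - prt b (v t) x.
  have lD : L2 D by apply: L2B l3; apply: L2Z; exact: L2B.
  have -> : (fun x => prt b (u r) x - prt b (u t) x) =
      (fun x => (r - t) * (D x + prt b (v t) x)).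
    by apply/funext => x; rewrite /D subrK mulVKf.
  rewrite n2Z; last exact: L2D.
  move: re; rewrite ltr_pdivlMr// => /ltW; apply: le_trans.
  rewrite ler_wpM2l//; apply: (le_trans (n2_triangle lD l3)).
  rewrite lerD2r.
  have := hd r rT rt rd; rewrite expr1n => h.
  rewrite -[leRHS]sqrtr1 ler_wsqrtr//; apply: le_trans h.
  have -> : D = prt b (fun x => ((r - t)^-1)%:C%C * (u r x - u t x) - v t x).
    by apply/funext => x; rewrite /D /prt partB partZ partB.
  exact: ip_prt_le.
exists (M ^+ 2) => t /hM h.
rewrite -[leLHS]sqr_sqrtr ?ip_ge0// ler_sqr ?nnegrE ?sqrtr_ge0//.
exact: le_trans (n2_ge0 _) h.
Qed.

Lemma deriv_on_congr T (f f' g g' : R -> R) :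
  (forall t, 0 <= t <= T -> f t = f' t) -> (forall t, 0 <= t <= T -> g t = g' t) ->
  deriv_on T f g -> deriv_on T f' g'.
Proof.
move=> ff gg fg t tT e e0; have [d d0 hd] := fg t tT e e0.
by exists d => // r rT rt rd; rewrite -!ff// -gg//; exact: hd.
Qed.

Variables (q : R -> R) (lam : nat -> R) (phi : nat -> R -> R).
Hypothesis hphi : SL_eigenbasis q lam phi.

Lemma deriv_path_coef T (u v : R -> R -> R[i]) b n :
  (forall t, 0 <= t <= T -> L2C (u t)) -> (forall t, 0 <= t <= T -> L2C (v t)) ->
  deriv_path T u v ->
  deriv_on T (fun t => ip mu (prt b (u t)) (phi n)) (fun t => ip mu (prt b (v t)) (phi n)).
Proof.
move=> lu lv uv t tT e e0; have [d d0 hd] := deriv_path_nsq lu lv uv tT e0.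
exists d => // r rT rt rd.
have [l1 l2] := (L2_prt b (lu _ rT), L2_prt b (lu _ tT)).
have l3 := L2_prt b (lv _ tT).
have lp := eigenfun_L2 hphi n.
rewrite -ipBl// -ipZl//; last exact: L2B.
rewrite -ipBl//; last by apply: L2Z; exact: L2B.
rewrite -ler_sqr ?nnegrE ?(ltW e0)// real_normK ?num_real//.
apply: le_trans (hd r rT rt rd).
apply: (le_trans _ (ip_prt_le b _)).
have -> : (fun x => (r - t)^-1 * (prt b (u r) x - prt b (u t) x) - prt b (v t) x) =
   prt b (fun x => ((r - t)^-1)%:C%C * (u r x - u t x) - v t x).
  by apply/funext => x; rewrite /prt partB partZ partB.
apply: (le_trans (cauchy_schwarz _ lp)); last by rewrite (eigenfun_ortho hphi) eqxx mulr1.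
by apply: L2_prt; apply: L2C_B; [apply: L2C_rscale; apply: L2C_B; exact: lu|exact: lv].
Qed.

(** The real and imaginary parts of a solution are real solutions.  The function
    c1 in the equation for the n-th coefficient agrees on [0, T] with the
    coefficient of u_t, by uniqueness of derivatives. *)
Lemma solution_part T s (a b : R -> R) u0 u1 u v (i : bool) : 0 < T ->
  solution_with T q lam phi s a b u0 u1 u v ->
  real_solution T (fun n => lam n `^ s) phi a b
    (fun t => prt i (u t)) (fun t => prt i (v t)).
Proof.
move=> T0 [[hW _] [lv [duv cv]] _ _ hn].
have lu t : 0 <= t <= T -> L2C (u t) by move=> /hW[].
have [M1 h1] := deriv_path_bounded i (ltW T0) lu lv duv.
have [M2 h2] := cont_path_bounded i (ltW T0) lv cv.
have dn n := deriv_path_coef i n lu lv duv.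
split.
- by move=> t tT; split; apply: L2_prt; [exact: lu|exact: lv].
- exists (Num.max M1 M2) => t tT; rewrite !le_max h1// h2//.
  by rewrite orbT.
- exact: dn.
- move=> n; have [c1 [c2 [d1 d2 eqn]]] := hn n.
  have d1' := deriv_scal_part i d1; have d2' := deriv_scal_part i d2.
  apply: deriv_on_congr d2'.
    apply: (@deriv_on_unique R T _ _ _ T0 d1').
    by apply: deriv_on_congr (dn n) => // t _; rewrite part_coef.
  move=> t tT; have /(congr1 (part i)) := eqn t tT.
  rewrite !partD partZ !part_coef.
  have -> : part i 0 = 0 by case: (i).
  have -> : prt i (fun x => (a x)%:C%C * u t x + (b x)%:C%C * v t x) =
     (fun x => a x * prt i (u t) x + b x * prt i (v t) x).
    by apply/funext => x; rewrite /prt partD !partZ.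
  by move/eqP; rewrite -addrA addr_eq0 opprD => /eqP.
Qed.

End Parts.

(** * Stability of solutions *)

Section Stability.
Context {R : realType}.
Notation mu := (leb01 R).
Notation L2 f := (f \in Lfun mu 2%:E).

(** Convergence to 0 of nonnegative extended reals. *)
Lemma cvge0_le (X : Type) (F : set_system X) {FF : Filter F} (f : X -> \bar R) :
  (forall e : R, 0 < e -> \forall x \near F, (0 <= f x <= e%:E)%E) -> f @ F --> 0%E.
Proof.
move=> h; apply/fine_cvgP; split.
  apply: filterS (h 1 ltr01) => x /andP[f0 f1].
  by rewrite ge0_fin_numE// (le_lt_trans f1)// ltry.
apply/cvgrPdist_le => e /h; apply: filterS => x /andP[f0 fe].
have ffin : f x \is a fin_num by rewrite ge0_fin_numE// (le_lt_trans fe)// ltry.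
by rewrite sub0r normrN /= ger0_norm ?fine_ge0// -lee_fin fineK.
Qed.

Lemma normLinfty_ae_le (f : R -> R) (rho : R) :
  measurable_fun setT (f : measurableTypeR R -> R) ->
  (normLinfty f < rho%:E)%E -> \forall x \ae mu, f x ^+ 2 <= rho ^+ 2.
Proof.
move=> mf frho; have lf : Linfty f.
  apply/andP; split; rewrite inE//= /finite_norm.
  by apply: lt_trans frho _; rewrite ltry.
have [A [A0 AE]] := Linfty_bound lf.
apply: ae_imp => x /le_trans; apply.
move: frho; rewrite AE lte_fin => /ltW h.
by rewrite ler_sqr ?nnegrE// (le_trans A0).
Qed.

Variables (T s : R) (q : R -> R) (lam : nat -> R) (phi : nat -> R -> R).
Hypothesis T_gt0 : 0 < T.
Hypothesis hphi : SL_eigenbasis q lam phi.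

(** The energy of the initial difference.  The lower bound c0 on the eigenvalues of
    L^s is used here, to control the L^2 norm by the Sobolev norm. *)
Lemma initial_energy_le (c0 rho : R) (i : bool) (a b a' b' : R -> R)
    (u0 u1 u0' u1' : R -> R[i]) (u v u' v' : R -> R -> R[i]) n :
  0 < c0 -> (forall k, c0 <= lam k `^ s) -> 0 <= rho ->
  L2C u0 -> L2C u1 -> L2C u0' -> L2C u1' ->
  W_SL q lam phi s u0 -> W_SL q lam phi s u0' ->
  (normW_SL q lam phi s (fun x => (u0' x - u0 x)%R) <= rho%:E)%E ->
  (normL2 (fun x => (u1' x - u1 x)%R) <= rho%:E)%E ->
  solution_with T q lam phi s a b u0 u1 u v ->
  solution_with T q lam phi s a' b' u0' u1' u' v' ->
  \sum_(k < n)
    ((ip mu (prt i (v' 0)) (phi k) - ip mu (prt i (v 0)) (phi k)) ^+ 2 +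
    (lam k `^ s + 1) * (ip mu (prt i (u' 0)) (phi k) - ip mu (prt i (u 0)) (phi k)) ^+ 2)
  <= (2 + c0^-1) * rho ^+ 2.
Proof.
move=> c0_gt0 hc0 rho0 l0 l1 l0' l1' w0 w0' W1 N1.
move=> [[hW _] [hv _] e0 e1 _] [[hW' _] [hv' _] e0' e1' _].
have zT : 0 <= (0 : R) <= T by rewrite lexx ltW.
have phiL2 := eigenfun_L2 hphi; have ortho := eigenfun_ortho hphi.
have lp f : L2C f -> L2 (prt i f) by exact: L2_prt.
have trace (f g : R -> R[i]) k : L2C f -> L2C g -> ae_eqC f g ->
    ip mu (prt i f) (phi k) = ip mu (prt i g) (phi k).
  move=> lf lg fg; apply: ae_eq_ip => //; try exact: lp.
    exact: ae_eqC_prt.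
  exact: nearW.
have nsq_le f : L2C f -> (normL2 f <= rho%:E)%E -> nsq f <= rho ^+ 2.
  move=> lf; rewrite normL2E// lee_fin => h.
  by rewrite -[leLHS]sqr_sqrtr ?nsq_ge0// ler_sqr ?nnegrE ?sqrtr_ge0.
have lu : L2C (u 0) by case: (hW 0 zT).
have lu' : L2C (u' 0) by case: (hW' 0 zT).
have lv := hv 0 zT; have lv' := hv' 0 zT.
have [g [lg cg Wg]] := W_difference hphi w0' w0.
have h1 : \sum_(k < n) ip mu (prt i (fun x => u1' x - u1 x)) (phi k) ^+ 2 <= rho ^+ 2.
  have lB := L2C_B l1' l1.
  apply: (le_trans (bessel phiL2 ortho n (lp _ lB))).
  exact: le_trans (ip_prt_le _ _) (nsq_le _ lB N1).
have h2 : \sum_(k < n) ip mu (prt i g) (phi k) ^+ 2 <= rho ^+ 2.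
  apply: (le_trans (bessel phiL2 ortho n (lp _ lg))).
  by apply: le_trans (ip_prt_le _ _) (nsq_le _ lg _); rewrite -Wg.
have -> : (2 + c0^-1) * rho ^+ 2 = rho ^+ 2 + (1 + c0^-1) * rho ^+ 2 by ring.
have c1 : 0 <= 1 + c0^-1 by rewrite addr_ge0// invr_ge0 ltW.
rewrite big_split /=; apply: lerD.
  apply: le_trans h1; apply: ler_sum => k _.
  rewrite (trace _ _ k lv' l1' e1') (trace _ _ k lv l1 e1).
  by rewrite prtB ipBl//; exact: lp.
apply: (le_trans _ (ler_wpM2l c1 h2)); rewrite mulr_sumr; apply: ler_sum => k _.
rewrite (trace _ _ k lu' l0' e0') (trace _ _ k lu l0 e0).
rewrite -ipBl//; [|exact: lp|exact: lp].
rewrite -prtB -!part_coef cg partZ exprMn.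
set y := part i _ ^+ 2; have y0 : 0 <= y by exact: sqr_ge0.
rewrite -powR_mulrn ?powR_ge0// -powRrM divfK ?pnatr_eq0//.
have : 1 <= c0^-1 * lam k `^ s by rewrite ler_pdivlMl// mulr1.
by move=> h; rewrite [leRHS]mulrA ler_wpM2r// mulrDl mul1r lerD2l.
Qed.

(** Quantitative stability: if the coefficients and the initial data differ by at
    most rho, then the solutions differ by at most a constant times rho in L^2. *)
Lemma solution_stability (c0 rho A M t : R) (a b a' b' : R -> R)
    (u0 u1 u0' u1' : R -> R[i]) (u v u' v' : R -> R -> R[i]) :
  0 < c0 -> (forall k, c0 <= lam k `^ s) -> 0 <= rho -> 0 <= A ->
  L2C u1 -> L2C u1' ->
  W_SL q lam phi s u0 -> W_SL q lam phi s u0' ->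
  (normW_SL q lam phi s (fun x => (u0' x - u0 x)%R) <= rho%:E)%E ->
  (normL2 (fun x => (u1' x - u1 x)%R) <= rho%:E)%E ->
  measurable_fun setT (a : measurableTypeR R -> R) ->
  measurable_fun setT (b : measurableTypeR R -> R) ->
  measurable_fun setT (a' : measurableTypeR R -> R) ->
  measurable_fun setT (b' : measurableTypeR R -> R) ->
  (\forall x \ae mu, a' x ^+ 2 <= A) -> (\forall x \ae mu, b' x ^+ 2 <= A) ->
  (\forall x \ae mu, (a' x - a x) ^+ 2 <= rho ^+ 2) ->
  (\forall x \ae mu, (b' x - b x) ^+ 2 <= rho ^+ 2) ->
  solution_with T q lam phi s a b u0 u1 u v ->
  solution_with T q lam phi s a' b' u0' u1' u' v' ->
  (forall i y, 0 <= y <= T -> ip mu (prt i (u y)) (prt i (u y)) <= M /\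
    ip mu (prt i (v y)) (prt i (v y)) <= M) ->
  0 <= t <= T ->
  nsq (fun x => u' t x - u t x) <=
    4 * (2 + c0^-1 + 8 * M) * expR ((3 + 2 * (4 * A)) * t) * rho ^+ 2.
Proof.
move=> c0_gt0 hc0 rho0 A0 l1 l1' w0 w0' W1 N1 ma mb ma' mb' aA bA ae be hu hu' hM tT.
have key i : ip mu (prt i (fun x => u' t x - u t x)) (prt i (fun x => u' t x - u t x)) <=
    2 * ((2 + c0^-1) * rho ^+ 2 + 8 * rho ^+ 2 * M) * expR ((3 + 2 * (4 * A)) * t).
  rewrite prtB.
  apply: (real_stability (fun k => powR_ge0 (lam k) s) (eigenfun_L2 hphi)
    (eigenfun_ortho hphi) (eigenfun_complete hphi) (ltW T_gt0) A0 (sqr_ge0 rho)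
    ma mb ma' mb' aA bA ae be (solution_part hphi i T_gt0 hu)
    (solution_part hphi i T_gt0 hu') (hM i) _ tT) => n.
  by apply: (initial_energy_le i n c0_gt0 hc0 rho0 _ l1 _ l1' w0 w0' W1 N1 hu hu');
    [case: w0|case: w0'].
have h1 := key true; have h2 := key false.
rewrite nsq_prt; set E := expR _ in h1 h2 *; move: (lerD h1 h2).
by congr (_ <= _); ring.
Qed.

End Stability.

Unset Implicit Arguments.
Set Strict Implicit.

Theorem theorem5p1 (R : realType) (T s : R) (hT : 0 < T) (hs : 0 <= s)
  (q : R -> R) (hq : Linfty q)
  (lam : nat -> R) (phi : nat -> R -> R)
  (hphi : SL_eigenbasis q lam phi) (hlam : forall n, 0 < lam n)
  (a b : R -> R) (ha : Linfty a) (hb : Linfty b)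
  (ha0 : ae_ge0 a) (hb0 : ae_ge0 b)
  (u0 u1 : R -> R[i]) (hu0 : W_SL q lam phi s u0) (hu1 : L2C u1)
  (u : R -> R -> R[i]) (hu : solution T q lam phi s a b u0 u1 u)
  (aeps beps : R -> R -> R)
  (hae : forall e, 0 < e <= 1 -> Linfty (aeps e) /\ ae_ge0 (aeps e))
  (hbe : forall e, 0 < e <= 1 -> Linfty (beps e) /\ ae_ge0 (beps e))
  (hae_cvg : normLinfty (fun x => aeps e x - a x) @[e --> 0^'+] --> 0%E)
  (hbe_cvg : normLinfty (fun x => beps e x - b x) @[e --> 0^'+] --> 0%E)
  (u0eps u1eps : R -> R -> R[i])
  (hu0e : forall e, 0 < e <= 1 -> W_SL q lam phi s (u0eps e))
  (hu1e : forall e, 0 < e <= 1 -> L2C (u1eps e))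
  (hu0e_cvg :
     normW_SL q lam phi s (fun x => u0eps e x - u0 x) @[e --> 0^'+] --> 0%E)
  (hu1e_cvg : normL2 (fun x => u1eps e x - u1 x) @[e --> 0^'+] --> 0%E)
  (ueps : R -> R -> R -> R[i])
  (hue : forall e, 0 < e <= 1 ->
     solution T q lam phi s (aeps e) (beps e) (u0eps e) (u1eps e) (ueps e)) :
  forall t, 0 <= t <= T ->
    normL2 (fun x => ueps e t x - u t x) @[e --> 0^'+] --> 0%E.
Proof.
move=> t tT.
have [m m0 hm] := spectral_gap hq hphi hlam.
pose c0 := m `^ s.
have c0_gt0 : 0 < c0 by exact: powR_gt0.
have hc0 k : c0 <= lam k `^ s.
  by apply: ge0_ler_powR => //; rewrite nnegrE ltW.
have [Aa [Aa0 _] aAa] := Linfty_bound ha.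
have [Ab [Ab0 _] bAb] := Linfty_bound hb.
pose A := 2 * Aa ^+ 2 + 2 * Ab ^+ 2 + 2.
have A0 : 0 <= A by rewrite !addr_ge0// mulr_ge0// sqr_ge0.
have mLinfty (f : R -> R) : Linfty f -> measurable_fun setT (f : measurableTypeR R -> R).
  by case/andP => /[!inE].
have [v hv] := hu.
have [Mt hMt] := rs_bounded (solution_part hphi true hT hv).
have [Mf hMf] := rs_bounded (solution_part hphi false hT hv).
pose M := Num.max Mt Mf.
have hM i y : 0 <= y <= T ->
    ip (leb01 R) (prt i (u y)) (prt i (u y)) <= M /\
    ip (leb01 R) (prt i (v y)) (prt i (v y)) <= M.
  by move=> yT; case: i; [have [? ?] := hMt y yT|have [? ?] := hMf y yT];
    split; rewrite le_max; apply/orP; by [left|right].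
have M0 : 0 <= M.
  have zT : 0 <= (0 : R) <= T by rewrite lexx ltW.
  by have [h _] := hM true 0 zT; exact: le_trans (ip_ge0 _ _) h.
pose D := 4 * (2 + c0^-1 + 8 * M) * expR ((3 + 2 * (4 * A)) * t).
have D0 : 0 <= D.
  by rewrite !mulr_ge0 ?expR_ge0 ?addr_ge0 ?invr_ge0 ?mulr_ge0// ltW.
apply: cvge0_le => d d0.
(* rho is chosen so that D * rho ^+ 2 <= d ^+ 2; as rho <= 1, the constant A
   bounds aeps ^+ 2 and beps ^+ 2 *)
pose rho := Num.min 1 (d / (D + 1)).
have D1 : 0 < D + 1 by rewrite ltr_wpDl.
have rho0 : 0 < rho by rewrite lt_min ltr01 divr_gt0.
have rho1 : rho <= 1 by rewrite ge_min lexx.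
have Drho : D * rho ^+ 2 <= d ^+ 2.
  have rd : (D + 1) * rho <= d by rewrite mulrC -ler_pdivlMr// ge_min lexx orbT.
  apply: (@le_trans _ _ (((D + 1) * rho) ^+ 2)).
    by rewrite exprMn ler_wpM2r ?sqr_ge0// expr2; nra.
  by rewrite ler_sqr ?nnegrE ?(ltW d0)// mulr_ge0// ltW.
have nA : \forall e \near 0^'+, (normLinfty (fun x => (aeps e x - a x)%R) < rho%:E)%E.
  exact: cvge0_near hae_cvg _ rho0.
have nB : \forall e \near 0^'+, (normLinfty (fun x => (beps e x - b x)%R) < rho%:E)%E.
  exact: cvge0_near hbe_cvg _ rho0.
have n0 : \forall e \near 0^'+, (normW_SL q lam phi s (fun x => (u0eps e x - u0 x)%R) < rho%:E)%E.
  exact: cvge0_near hu0e_cvg _ rho0.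
have n1 : \forall e \near 0^'+, (normL2 (fun x => (u1eps e x - u1 x)%R) < rho%:E)%E.
  exact: cvge0_near hu1e_cvg _ rho0.
near=> e.
have e01 : 0 < e <= 1.
  by apply/andP; split; near: e; [exact: nbhs_right_gt|exact: nbhs_right_le].
have [lae _] := hae e e01; have [lbe _] := hbe e e01.
have [ve hve] := hue e e01.
have ma := mLinfty _ ha; have mb := mLinfty _ hb.
have mae := mLinfty _ lae; have mbe := mLinfty _ lbe.
have da : \forall x \ae leb01 R, (aeps e x - a x) ^+ 2 <= rho ^+ 2.
  by apply: normLinfty_ae_le; [exact: (measurable_funB mae ma)|near: e].
have db : \forall x \ae leb01 R, (beps e x - b x) ^+ 2 <= rho ^+ 2.
  by apply: normLinfty_ae_le; [exact: (measurable_funB mbe mb)|near: e].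
have rho21 : rho ^+ 2 <= 1 by rewrite expr_le1// ltW.
have bound (B : R) (f fe : R -> R) : 2 * B ^+ 2 + 2 <= A ->
    (\forall x \ae leb01 R, f x ^+ 2 <= B ^+ 2) ->
    (\forall x \ae leb01 R, (fe x - f x) ^+ 2 <= rho ^+ 2) ->
    \forall x \ae leb01 R, fe x ^+ 2 <= A.
  move=> BA; apply: ae_imp2 => x h1 h2.
  have := sqr_ge0 (fe x - 2 * f x); move: h1 h2 BA rho21; rewrite !expr2; nra.
have aA : \forall x \ae leb01 R, aeps e x ^+ 2 <= A.
  by apply: bound aAa da; rewrite /A lerD2r lerDl mulr_ge0// sqr_ge0.
have bA : \forall x \ae leb01 R, beps e x ^+ 2 <= A.
  by apply: bound bAb db; rewrite /A lerD2r lerDr mulr_ge0// sqr_ge0.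
have W1 : (normW_SL q lam phi s (fun x => (u0eps e x - u0 x)%R) <= rho%:E)%E.
  by apply: ltW; near: e.
have N1 : (normL2 (fun x => (u1eps e x - u1 x)%R) <= rho%:E)%E.
  by apply: ltW; near: e.
have := solution_stability hT hphi c0_gt0 hc0 (ltW rho0) A0 hu1 (hu1e e e01) hu0
  (hu0e e e01) W1 N1 ma mb mae mbe aA bA da db hv hve hM tT.
rewrite -/D => /le_trans/(_ Drho) h.
have lut : L2C (u t) by case: hv => [[/(_ t tT)[]]].
have luet : L2C (ueps e t) by case: hve => [[/(_ t tT)[]]].
rewrite normL2E; last exact: L2C_B.
rewrite !lee_fin sqrtr_ge0 /= -[leRHS]ger0_norm ?(ltW d0)// -sqrtr_sqr.
by rewrite ler_wsqrtr.
Unshelve. all: by end_near.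
Qed.
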